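(* Let $K$ be a non-archimedean local field of characteristic $p>0$, with ring of integers $\mathcal{O}_K$ and residue field of cardinality $q$. Let $m\ge 2$ be an integer with $p\nmid m$, and let $f(x)\in\mathcal{O}_K[x]$ be a polynomial of degree $n\ge 1$ which splits completely over $K$, with factorization $$f(x)=\gamma_0\prod_{i=1}^k(x-\gamma_i)^{n_i},$$ where $\gamma_0\in K^\times$, $\gamma_1,\dots,\gamma_k\in K$ are pairwise distinct, $n_i\ge 1$ and $\sum_{i=1}^k n_i=n$. Let $g(x,y)=y^m-f(x)$. Then for every multiplicative character $\chi$ of $\mathcal{O}_K^\times$, $Z_g(s,\chi)$ is a rational function of $q^{-s}$; more precisely, there is $G(x)\in\mathbb{C}[x]$ such that for $\mathrm{Re}(s)>0$ $$Z_g(s,\chi)=\frac{G(q^{-s})}{(1-q^{-1-s})\prod_{i\in T,\ n_i\ge 2}\bigl(1-q^{-\tilde n_i-m_i-\tilde n_im_i\gcd(n_i,m)s}\bigr)},$$ where $T=\{i: 1\le i\le k,\ \gamma_i\in\mathcal{O}_K\}$, $\tilde n_i=n_i/\gcd(n_i,m)$ and $m_i=m/\gcd(n_i,m)$.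
   Context: $\mathcal{O}_K^\times$ is the unit group of $\mathcal{O}_K$, $\pi$ a uniformizer, $q=\#(\mathcal{O}_K/\pi\mathcal{O}_K)$. For $x\in K^\times$, $\mathrm{ord}(x)$ is the valuation with $\mathrm{ord}(\pi)=1$, $x=ac(x)\pi^{\mathrm{ord}(x)}$ with $ac(x)\in\mathcal{O}_K^\times$, and $|x|=q^{-\mathrm{ord}(x)}$, $|0|=0$. $|dx|$ is the Haar measure on $K^n$ with $\mathcal{O}_K^n$ of measure $1$. For a multiplicative character $\chi:\mathcal{O}_K^\times\to\mathbb{C}^\times$ extended by $\chi(0)=0$, and $f\in\mathcal{O}_K[x_1,\dots,x_n]$, $Z_f(s,\chi)=\int_{\mathcal{O}_K^n}\chi(ac\, f(x))|f(x)|^s|dx|$ for $\mathrm{Re}(s)>0$. An empty product is $1$. *)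

(* Defs.v *)
From HB Require Import structures.
From mathcomp Require Import all_boot all_order all_algebra.
From mathcomp Require Export complex.
From mathcomp Require Import finmap.
From mathcomp Require Import all_classical all_reals all_analysis.

Set Implicit Arguments.
Unset Strict Implicit.
Unset Printing Implicit Defensive.

Import Order.TTheory GRing.Theory Num.Theory.
Import numFieldNormedType.Exports.

Local Open Scope classical_set_scope.
Local Open Scope ring_scope.

(* A valuation is a function [v : K -> int]; its value at [0] (morally +oo) is
   irrelevant, so every use of [v x] below is guarded by [x != 0]. *)
Section Valuation.
Variables (K : fieldType) (v : K -> int).

Definition valuation_ideal (n : int) : {pred K} :=
  fun x => (x == 0) || (n <= v x).

Definition valuation_ring : {pred K} := valuation_ideal 0.

Definition valuation_units : {pred K} := fun x => (x != 0) && (v x == 0).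

(* The quotient of the valuation ring by its maximal ideal, as a set of
   cosets. *)
Definition residue_classes : set (set K) :=
  [set [set y | y - x \in valuation_ideal 1] | x in [set` valuation_ring]].

End Valuation.

(* A non-archimedean local field: a field that is complete for a normalized
   discrete valuation with finite residue field. *)
HB.mixin Record Uniform_isLocalField K & GRing.Field K & Uniform K := {
  ord : K -> int;
  ordM : forall x y : K, x != 0 -> y != 0 -> ord (x * y) = ord x + ord y;
  ordD : forall x y : K, x != 0 -> y != 0 -> x + y != 0 ->
    Num.min (ord x) (ord y) <= ord (x + y);
  ord_uniformizer : exists2 x : K, x != 0 & ord x = 1;
  entourage_ordE : @entourage K =
    filter_from [set: int]
      (fun n => [set z | z.1 - z.2 \in valuation_ideal ord n]);
  cauchy_ord_cvg : forall F : set_system K, ProperFilter F -> cauchy F ->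
    exists x : K, F --> x;
  residue_finite : finite_set (residue_classes ord)
}.

#[short(type="localFieldType")]
HB.structure Definition LocalField :=
  {K of GRing.Field K & Uniform K & Uniform_isLocalField K}.

(* [a ^ s] for a real [a >= 0] and a complex [s], with [0 ^ s = 0] (used only
   for [Re s > 0]). *)
Definition cpow (R : realType) (a : R) (s : R[i]) : R[i] :=
  if a == 0 then 0 else
  ((expR (complex.Re s * ln a) * cos (complex.Im s * ln a)) +i*
   (expR (complex.Re s * ln a) * sin (complex.Im s * ln a)))%C.

Definition cintegral d (T : measurableType d) (R : realType)
    (mu : {measure set T -> \bar R}) (D : set T) (F : T -> R[i]) : R[i] :=
  (Rintegral mu D (fun x => complex.Re (F x)) +i*
   Rintegral mu D (fun x => complex.Im (F x)))%C.

(* Measurable types are pointed. *)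
HB.instance Definition _ (K : localFieldType) :=
  isPointed.Build (LocalField.sort K) 0.

Section LocalZeta.
Variable K : localFieldType.

Definition integers : {pred K} := valuation_ring (@ord K).

Definition units : {pred K} := valuation_units (@ord K).

Definition residue_card : nat := #|` fset_set (residue_classes (@ord K))|.

Definition uniformizer (pi : K) : Prop := pi != 0 /\ ord pi = 1.

(* [ac 0 = 0] *)
Definition ac (pi x : K) : K := x * pi ^ (- ord x).

Definition lnorm (R : realType) (x : K) : R :=
  if x == 0 then 0 else residue_card%:R ^ (- ord x).

(* A continuous homomorphism from the units to the nonzero complex numbers,
   extended by [chi 0 = 0]; values elsewhere are irrelevant. *)
Definition mult_character (R : realType) (chi : K -> R[i]) : Prop :=
  [/\ chi 0 = 0,
      {in units, forall u, chi u != 0},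
      {in units &, {morph chi : u w / u * w}} &
      {within [set` units], continuous (chi : K -> (R[i] : numFieldType))}].

Definition borel2 : Type := g_sigma_algebraType (@open (K * K)%type).

Definition integers2 : set borel2 :=
  [set z : K * K | z.1 \in integers /\ z.2 \in integers].

(* Together with translation invariance, the normalization makes the measure
   finite on compact sets, so this determines it uniquely on Borel sets. *)
Definition normalized_haar (R : realType) (mu : {measure set borel2 -> \bar R})
    : Prop :=
  mu integers2 = 1%E /\
  forall (a : K * K) (A : set borel2), measurable A ->
    mu [set a + z | z in (A : set (K * K))] = mu A.

(* The zeta function of a polynomial map [F] in two variables. *)
Definition local_zeta (R : realType) (mu : {measure set borel2 -> \bar R})
    (pi : K) (chi : K -> R[i]) (F : K * K -> K) (s : R[i]) : R[i] :=
  cintegral mu integers2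
    (fun z => chi (ac pi (F z)) * cpow (lnorm R (F z)) s).

End LocalZeta.

(* Main.v *)
Require Import Defs.
From HB Require Import structures.
From mathcomp Require Import all_boot all_order all_algebra.
From mathcomp Require Import finmap.
From mathcomp Require Import all_classical all_reals all_analysis.
From mathcomp Require Import zify ring lra.

(** Write [t = q^-s].  Since [chi] is trivial on some [1 + pi^c O], the integral
    over a clopen set [A] is the power series in [t] with coefficients
    [a_k(A) = sum_u chi(u) vol {z in A | g(z) in u pi^k + pi^(k+c) O}], [u] running
    over the units modulo [pi^c].  It remains to find linear recurrences for the
    [a_k(A)].

    On a set where the orders of [g], [g_x], [g_y] are not simultaneously large,
    translating small boxes permutes the residue subclasses of a level set, so
    [a_(k+1) = a_k / q] for large [k]; this gives the factor [1 - t / q].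

    The only other points are the [(gamma_i, 0)] with [n_i >= 2].  There
    [g = y^m - x^(n_i) H(x)] in the coordinate [x - gamma_i], and the map
    [(x, y) |-> (pi^(m_i) x, pi^(n~_i) w(x) y)] with
    [w(x)^m ~ H(pi^(m_i) x) / H(x)] multiplies [g] by [pi^l], [l = lcm (n_i, m)], up
    to a principal unit.  It sends the neighbourhood [N] of the point onto a
    smaller one, whose complement in [N] is nonsingular, and scales volumes by
    [q^-(m_i + n~_i)]; hence the factor [1 - q^-(m_i + n~_i) t^l]. *)

(** Since [p] does not divide [m], [g_y = m y^(m-1)] vanishes only at [y = 0], where a common zero
    of [g] and [g_x] is a multiple root of [f]. The characteristic may divide [n_i], so the unit
    [H(pi^(m_i) x) / H(x)] cannot in general be absorbed into [x] by an [n_i]-th root; it is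
    absorbed into [y]. Complete splitting of [f] makes this unit an explicit product of quotients of
    affine functions close to 1.

    The root is needed only to the precision of one level set, so a different approximate root may
    serve for each [k]: the recurrences compare volumes one [k] at a time. For these volumes no
    general change of variables is invoked; the sets are finite unions of boxes.

    The neighbourhoods have radius [e = e1 + c], where [e1] bounds the orders of the differences
    [gamma_i - gamma_j]. There the unit lies in [1 + pi^c O], where [chi] is trivial.

    Recurrences pass from coefficients to values through partial sums with error a multiple of
    [|t|^L]; the finitely many initial terms become polynomials in [t] that do not depend on [s]. *)

Set Implicit Arguments.
Unset Strict Implicit.
Unset Printing Implicit Defensive.

Import Order.TTheory GRing.Theory Num.Theory.
Import numFieldNormedType.Exports.
Local Open Scope classical_set_scope.
Local Open Scope ring_scope.

(** * Valuations *)

(* [lia] does not identify convertible but syntactically different occurrences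
   of [ord x]; generalizing them first makes them atoms. *)
Ltac ord_lia :=
  intros; repeat match goal with H : context [@ord _ _] |- _ => move: H end;
  repeat match goal with |- context [@ord ?K ?x] => move: (@ord K x) => ? end;
  lia.

Section Valuation.
Variable K : localFieldType.
Implicit Types (x y z : K) (a b n : int).

(** Convertible to membership in [valuation_ideal ord n] and silently exchanged with it. Integer
    exponents are needed to bound the inverses of [gamma_i - gamma_j]. *)
Definition ideal n x : bool := (x == 0) || (n <= ord x).

Lemma ord_mul x y : x != 0 -> y != 0 -> ord (x * y) = ord x + ord y.
Proof. exact: ordM. Qed.

Lemma ord_add x y : x != 0 -> y != 0 -> x + y != 0 ->
  Num.min (ord x) (ord y) <= ord (x + y).
Proof. exact: ordD. Qed.

Lemma ideal0 n : ideal n 0.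
Proof. by rewrite /ideal eqxx. Qed.

Lemma ord_one : ord (1 : K) = 0.
Proof. by have := ord_mul (oner_neq0 K) (oner_neq0 K); rewrite mulr1; ord_lia. Qed.

Lemma ordV x : x != 0 -> ord x^-1 = - ord x.
Proof.
move=> x0; have := @ord_mul x x^-1 x0; rewrite invr_eq0 mulfV // ord_one.
by move=> /(_ x0); ord_lia.
Qed.

Lemma ordX x (k : nat) : x != 0 -> ord (x ^+ k) = k%:Z * ord x.
Proof.
move=> x0; elim: k => [|k IH]; first by rewrite expr0 ord_one mul0r.
by rewrite exprS ord_mul ?expf_neq0 // IH; ord_lia.
Qed.

Lemma ordN1 : ord (-1 : K) = 0.
Proof.
have N1 : (-1 : K) != 0 by rewrite oppr_eq0 oner_neq0.
by have := ord_mul N1 N1; rewrite mulrNN mulr1 ord_one; ord_lia.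
Qed.

Lemma ordN x : ord (- x) = ord x.
Proof.
have [->|x0] := eqVneq x 0; first by rewrite oppr0.
by rewrite -mulN1r ord_mul ?oppr_eq0 ?oner_neq0 // ordN1 add0r.
Qed.

Lemma idealN n x : ideal n (- x) = ideal n x.
Proof. by rewrite /ideal oppr_eq0 ordN. Qed.

Lemma idealD n x y : ideal n x -> ideal n y -> ideal n (x + y).
Proof.
rewrite /ideal; have [->|x0] := eqVneq x 0; first by rewrite add0r.
have [->|y0] := eqVneq y 0; first by rewrite addr0 (negPf x0).
by have [//|s0 /= xn yn] := eqVneq (x + y) 0; have := ord_add x0 y0 s0; ord_lia.
Qed.

Lemma idealB n x y : ideal n x -> ideal n y -> ideal n (x - y).
Proof. by move=> xn yn; apply: idealD; rewrite ?idealN. Qed.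

Lemma idealBC n x y : ideal n (x - y) = ideal n (y - x).
Proof. by rewrite -idealN opprB. Qed.

Lemma ideal_trans n x y z : ideal n (x - y) -> ideal n (y - z) -> ideal n (x - z).
Proof. by move=> h1 h2; rewrite -(subrKA y); exact: idealD. Qed.

Lemma idealM a b x y : ideal a x -> ideal b y -> ideal (a + b) (x * y).
Proof.
rewrite /ideal mulf_eq0; have [//|x0] := eqVneq x 0.
by have [//|y0 /= xa yb] := eqVneq y 0; rewrite ord_mul //; ord_lia.
Qed.

Lemma ideal_le a b x : a <= b -> ideal b x -> ideal a x.
Proof. by move=> ab; rewrite /ideal => /orP[->//|bx]; ord_lia. Qed.

Lemma ideal_mulr n x y : ideal 0 x -> ideal n y -> ideal n (x * y).
Proof. by move=> h1 h2; have := idealM h1 h2; rewrite add0r. Qed.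

Lemma idealX n x (k : nat) : ideal n x -> ideal (k%:Z * n) (x ^+ k).
Proof.
move=> xn; elim: k => [|k IH]; first by rewrite expr0 mul0r /ideal ord_one lexx orbT.
by rewrite exprS; have := idealM xn IH; congr ideal; ord_lia.
Qed.

Lemma idealX0 x (k : nat) : ideal 0 x -> ideal 0 (x ^+ k).
Proof. by move=> /(@idealX 0 x k); rewrite mulr0. Qed.

Lemma ideal1 : ideal 0 1.
Proof. by rewrite /ideal ord_one lexx orbT. Qed.

Lemma ideal_nat (k : nat) : ideal 0 (k%:R : K).
Proof.
elim: k => [|k IH]; first exact: ideal0.
by rewrite -addn1 natrD; apply: idealD => //; exact: ideal1.
Qed.

Lemma ideal_ord x : ideal (ord x) x.
Proof. by rewrite /ideal lexx orbT. Qed.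

Lemma idealNP n x : ~~ ideal n x -> x != 0 /\ ord x < n.
Proof. by rewrite /ideal negb_or => /andP[]; rewrite -ltNge. Qed.

(** The ultrametric inequality for [y = x + (y - x)] and for [x = y - (y - x)] bounds each order by
    the other. *)
Lemma ord_dominant x y n : x != 0 -> ord x < n -> ideal n (y - x) ->
  y != 0 /\ ord y = ord x.
Proof.
move=> x0 xn hd; have y0 : y != 0.
  by apply/eqP => y0; move: hd; rewrite y0 sub0r idealN /ideal (negPf x0) /=; ord_lia.
split=> //; move: hd; rewrite /ideal => /orP[|hd].
  by rewrite subr_eq0 => /eqP->.
have [e|d0] := eqVneq (y - x) 0; first by move/eqP: e; rewrite subr_eq0 => /eqP->.
have hx : y - (y - x) != 0 by rewrite subKr.
have Nd0 : - (y - x) != 0 by rewrite oppr_eq0.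
have := ord_add y0 Nd0 hx; rewrite subKr ordN.
have hy : x + (y - x) != 0 by rewrite subrKC.
have := ord_add x0 d0 hy; rewrite subrKC.
by ord_lia.
Qed.

Lemma ord_prod (J : finType) (P : pred J) (F : J -> K) :
  (forall j, P j -> F j != 0) ->
  ord (\prod_(j | P j) F j) = \sum_(j | P j) ord (F j).
Proof.
move=> F0; suff [] : ord (\prod_(j | P j) F j) = \sum_(j | P j) ord (F j) /\
  \prod_(j | P j) F j != 0 by [].
apply: (big_ind2 (fun x n => ord x = n /\ x != 0)).
- by rewrite ord_one oner_neq0.
- by move=> x a y b [<- x0] [<- y0]; rewrite ord_mul // mulf_neq0.
- by move=> j Pj; split => //; exact: F0.
Qed.

Lemma ideal_div n x y : x != 0 -> ideal (n + ord x) y -> ideal n (y / x).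
Proof.
move=> x0 hy; have := idealM hy (ideal_ord x^-1); rewrite ordV //.
by congr ideal; ord_lia.
Qed.

Lemma ideal_unitl n x y : x != 0 -> ord x = 0 -> ideal n (x * y) = ideal n y.
Proof.
by move=> x0 ox; rewrite /ideal mulf_eq0 (negPf x0) /=; case: eqVneq => //= y0;
  rewrite ord_mul // ox add0r.
Qed.

Lemma ideal_scale n a x y : x != 0 -> ord x = a -> ideal (n + a) (x * y) = ideal n y.
Proof.
move=> x0 ox; rewrite /ideal mulf_eq0 (negPf x0) /=; case: eqVneq => //= y0.
by rewrite ord_mul // ox; ord_lia.
Qed.

Lemma one_unit (x : K) n : 1 <= n -> ideal n (x - 1) -> x != 0 /\ ord x = 0.
Proof.
move=> n1 h; rewrite -ord_one; apply: (@ord_dominant 1 x n) => //.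
  exact: oner_neq0.
by rewrite ord_one; ord_lia.
Qed.

Lemma ideal_oneM n x y : 0 <= n -> ideal n (x - 1) -> ideal n (y - 1) ->
  ideal n (x * y - 1).
Proof.
move=> n0 hx hy; have -> : x * y - 1 = (x - 1) * (y - 1) + (x - 1) + (y - 1) by ring.
apply: (idealD _ hy); apply: (idealD _ hx).
by apply: (ideal_mulr _ hy); exact: ideal_le hx.
Qed.

Lemma ideal_oneX n x (k : nat) : 0 <= n -> ideal n (x - 1) -> ideal n (x ^+ k - 1).
Proof.
move=> n0 h; elim: k => [|k IH]; first by rewrite expr0 subrr ideal0.
by rewrite exprS; exact: ideal_oneM.
Qed.

(** Induction along Horner's scheme [P X + c] yields the remainder [P'(x) + r (x + h)] without
    dividing by 2, so characteristic 2 is covered. *)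
Lemma poly_taylor (P : {poly K}) : (forall i, ideal 0 P`_i) ->
  forall x h, ideal 0 x -> ideal 0 h ->
  exists2 r, ideal 0 r & P.[x + h] = P.[x] + P^`().[x] * h + r * h ^+ 2.
Proof.
move=> hP x h hx hh; elim/poly_ind: P hP => [|P c IH] hP.
  by exists 0; rewrite ?ideal0 // deriv0 !horner0 !mul0r !addr0.
have [i|r hr E] := IH; first by have := hP i.+1; rewrite coefD coefMX coefC /= addr0.
have hPi i : ideal 0 P`_i by have := hP i.+1; rewrite coefD coefMX coefC /= addr0.
have hdP : ideal 0 P^`().[x].
  rewrite horner_coef; elim/big_ind: _ => [|u v|i _]; [exact: ideal0|exact: idealD|].
  rewrite coef_deriv; apply: ideal_mulr; last exact: idealX0.
  by rewrite -mulr_natl; apply: ideal_mulr => //; exact: ideal_nat.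
exists (P^`().[x] + r * (x + h)).
  by apply: idealD => //; apply: ideal_mulr => //; exact: idealD.
by rewrite derivMXaddC !hornerMXaddC hornerD hornerMX E; ring.
Qed.

End Valuation.

(** * Representatives and topology *)

Section Representatives.
Variables (K : localFieldType) (pi : K).
Hypothesis pi_unif : uniformizer pi.
Implicit Types (x y z : K) (n : nat) (r : seq K).

Lemma pi_neq0 : pi != 0. Proof. by case: pi_unif. Qed.

Lemma piX_neq0 n : pi ^+ n != 0. Proof. by rewrite expf_neq0 // pi_neq0. Qed.

Lemma ord_piX n : ord (pi ^+ n) = n.
Proof. by case: pi_unif => p0 p1; rewrite ordX // p1 mulr1. Qed.

Lemma ideal_piXl (a : int) n x : ideal (a + n) (pi ^+ n * x) = ideal a x.
Proof. by rewrite ideal_scale ?piX_neq0 ?ord_piX. Qed.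

Lemma ideal_piX n : ideal n (pi ^+ n).
Proof. by have := ideal_ord (pi ^+ n); rewrite ord_piX. Qed.

(** A transversal of [O / pi^n], as a list because it indexes finite sums. *)
Definition is_reps n r := [/\ uniq r, {in r, forall x, ideal 0 x},
  forall x, ideal 0 x -> exists2 y, y \in r & ideal n (x - y) &
  {in r &, forall x y, ideal n (x - y) -> x = y}].

Lemma residue_reps : exists2 r, is_reps 1 r & size r = residue_card K.
Proof.
pose cls x : set K := [set y | ideal 1 (y - x)].
have clsE (x y : K) : cls x = cls y <-> ideal 1 (x - y).
  split=> [e|xy].
    by have : cls y x by rewrite -e /cls /= subrr ideal0.
  apply/seteqP; split => z /= h; first exact: ideal_trans h xy.
  by apply: ideal_trans h _; rewrite idealBC.
pose rep (C : set K) : K := get [set x | ideal 0 x /\ C = cls x].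
pose S := fset_set (residue_classes (@ord K)).
have repP C : C \in S -> ideal 0 (rep C) /\ C = cls (rep C).
  rewrite in_fset_set; last exact: residue_finite.
  rewrite inE => -[x hx <-]; rewrite /rep.
  by apply: (@getPex _ [set y | ideal 0 y /\ cls x = cls y]); exists x.
have inS x : ideal 0 x -> cls x \in S.
  move=> hx; rewrite in_fset_set; last exact: residue_finite.
  by rewrite inE; exists x.
have rep_inj : {in S &, injective rep}.
  by move=> C C' /repP[_ e] /repP[_ e'] ee; rewrite e e' ee.
exists [seq rep C | C <- S]; last by rewrite size_map.
split.
- by rewrite map_inj_in_uniq // fset_uniq.
- by move=> x /mapP[C /repP[h _] ->].
- move=> x hx; exists (rep (cls x)); first by apply: map_f; exact: inS.
  by apply/clsE; have [_ <-] := repP _ (inS _ hx).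
- move=> _ _ /mapP[C CS ->] /mapP[D DS ->] /clsE e.
  by congr rep; have [_ ->] := repP _ CS; have [_ ->] := repP _ DS.
Qed.

(** Truncated [pi]-adic expansions: [pi^n y] appends the digit [y] to a representative modulo
    [pi^n]. *)
Lemma reps_exist n : exists2 r, is_reps n r & size r = (residue_card K ^ n)%N.
Proof.
elim: n => [|n [r [ru r0 rex rin] sr]].
  exists [:: 0]; last by rewrite expn0.
  split=> //.
  - by move=> x; rewrite inE => /eqP->; exact: ideal0.
  - by move=> x hx; exists 0; rewrite ?mem_head // subr0.
  - by move=> x y; rewrite !inE => /eqP-> /eqP->.
have [t [tu t0 tex tin] st] := residue_reps.
have key x x' y y' : x \in r -> x' \in r -> y \in t -> y' \in t ->
    ideal n.+1 ((x + pi ^+ n * y) - (x' + pi ^+ n * y')) -> x = x' /\ y = y'.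
  move=> xr xr' yt yt' h; have ex : x = x'.
    apply: rin => //.
    have -> : x - x' = ((x + pi ^+ n * y) - (x' + pi ^+ n * y'))
       - pi ^+ n * (y - y') by ring.
    apply: idealB; first by apply: ideal_le h; lia.
    by have := ideal_piXl 0 n (y - y'); rewrite add0r => ->; apply: idealB; apply: t0.
  split=> //; apply: tin => //; rewrite -(ideal_piXl _ n).
  by move: h; rewrite ex; congr ideal; ring.
exists [seq x + pi ^+ n * y | x <- r, y <- t]; last first.
  by rewrite size_allpairs sr st expnSr.
split.
- apply: allpairs_uniq => // -[x y] [x' y'] /allpairsP[[a b] /= [ar bt [-> ->]]].
  move=> /allpairsP[[a' b'] /= [ar' bt' [-> ->]]] e.
  have [|-> -> //] := key a a' b b' ar ar' bt bt'.
  by rewrite e subrr ideal0.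
- move=> _ /allpairsP[[a b] /= [ar bt ->]]; apply: idealD; first exact: r0.
  by apply: ideal_mulr; [apply: ideal_le (ideal_piX n) | exact: t0].
- move=> x hx; have [a ar ha] := rex x hx.
  have h0 : ideal 0 ((x - a) / pi ^+ n).
    by apply: ideal_div; rewrite ?piX_neq0 // ord_piX add0r.
  have [b bt hb] := tex _ h0; exists (a + pi ^+ n * b).
    by apply/allpairsP; exists (a, b).
  have -> : x - (a + pi ^+ n * b) = pi ^+ n * ((x - a) / pi ^+ n - b).
    by field; rewrite piX_neq0.
  by rewrite (ideal_piXl 1 n).
- move=> _ _ /allpairsP[[a b] /= [ar bt ->]] /allpairsP[[a' b'] /= [ar' bt' ->]].
  by move=> /key[] // -> ->.
Qed.

Lemma residue_card_gt1 : (1 < residue_card K)%N.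
Proof.
have [r [ru r0 rex rin] <-] := residue_reps.
have [a ar ha] := rex 0 (ideal0 _ _); have [b br hb] := rex 1 (ideal1 _).
have ab : a != b.
  apply/eqP => e; move: ha; rewrite e idealBC => ha.
  have := idealD hb ha; rewrite subr0 subrK /ideal oner_eq0 ord_one //.
have : uniq [:: a; b] by rewrite /= inE ab.
by move=> /uniq_leq_size; apply => c; rewrite !inE => /orP[]/eqP->.
Qed.

End Representatives.

Section Topology.
Variable K : localFieldType.
Implicit Types (w z : K * K) (S : set (K * K)).

Definition box z (a b : int) : set (K * K) :=
  [set w | ideal a (w.1 - z.1) /\ ideal b (w.2 - z.2)].

(** Unions of cosets of [(pi^N O)^2]. They form a Boolean algebra, are Borel, and inside [O2] are
    finite unions of boxes, so that volumes reduce to counting. *)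
Definition saturated (N : int) S := forall z w, S z -> box z N N w -> S w.

Lemma nbhs_ideal (x : K) (n : int) : nbhs x [set y | ideal n (y - x)].
Proof.
have h : entourage [set z : K * K | z.1 - z.2 \in valuation_ideal (@ord K) n].
  by rewrite entourage_ordE; exists n.
have := nbhs_entourage x h; apply: filterS => y.
by rewrite /xsection /= inE => hy; rewrite idealBC.
Qed.

Lemma nbhs_box z (a b : int) : nbhs z (box z a b).
Proof.
case: z => x y; exists ([set x' | ideal a (x' - x)], [set y' | ideal b (y' - y)]) => /=.
  by split; exact: nbhs_ideal.
by move=> [u v] /=.
Qed.

Lemma box_refl z a b : box z a b z.
Proof. by split; rewrite subrr ideal0. Qed.

Lemma box_sym z w a b : box z a b w -> box w a b z.
Proof. by move=> [h1 h2]; split; rewrite idealBC. Qed.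

Lemma box_trans z w u a b : box z a b w -> box w a b u -> box z a b u.
Proof. by move=> [h1 h2] [h3 h4]; split; [exact: ideal_trans h3 h1|exact: ideal_trans h4 h2]. Qed.

Lemma box_le z w a b a' b' : a' <= a -> b' <= b -> box z a b w -> box z a' b' w.
Proof. by move=> h h' [h1 h2]; split; [exact: ideal_le h1|exact: ideal_le h2]. Qed.

Lemma locally_box_open S :
  (forall z, S z -> exists n : int, box z n n `<=` S) -> open S.
Proof.
move=> h; rewrite openE => z /h[n hn]; rewrite /interior.
exact: filterS hn (nbhs_box z n n).
Qed.

Lemma saturated_open N S : saturated N S -> open S.
Proof. by move=> h; apply: locally_box_open => z Sz; exists N => w; exact: h. Qed.

Lemma saturated_le N N' S : N <= N' -> saturated N S -> saturated N' S.
Proof. by move=> le h z w Sz zw; apply: h Sz _; exact: box_le zw. Qed.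

Lemma saturated_box z a b N : a <= N -> b <= N -> saturated N (box z a b).
Proof. by move=> aN bN u v zu uv; apply: box_trans zu _; exact: box_le uv. Qed.

Lemma saturatedI N S T : saturated N S -> saturated N T -> saturated N (S `&` T).
Proof. by move=> hS hT z w [Sz Tz] zw; split; [exact: hS zw|exact: hT zw]. Qed.

Lemma saturatedC N S : saturated N S -> saturated N (~` S).
Proof. by move=> hS z w nS zw Sw; apply: nS; apply: hS Sw _; exact: box_sym. Qed.

Lemma saturatedD N S T : saturated N S -> saturated N T -> saturated N (S `\` T).
Proof. by move=> hS hT; rewrite setDE; apply: saturatedI => //; exact: saturatedC. Qed.

Lemma saturated_measurable N S : saturated N S -> measurable (S : set (borel2 K)).
Proof. by move=> h; apply: sub_sigma_algebra; exact: saturated_open h. Qed.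

End Topology.

(** * Volumes *)

Section Additive.
Variables (K : localFieldType) (V : zmodType).
Implicit Types (S A B : set (borel2 K)).

(** The values lie in an arbitrary additive group because both the real volume and the complex
    integral [zeta] are cut along partitions. *)
Definition finitely_additive (nu : set (borel2 K) -> V) := forall A B,
  measurable A -> measurable B -> A `<=` @integers2 K -> B `<=` @integers2 K ->
  A `&` B = set0 -> nu (A `|` B) = nu A + nu B.

Lemma additive_partition (nu : set (borel2 K) -> V) (J : eqType) (s : seq J)
    (F : J -> set (borel2 K)) S :
  finitely_additive nu -> uniq s ->
  (forall j, j \in s -> measurable (F j)) ->
  (forall j, j \in s -> F j `<=` @integers2 K) ->
  (forall i j z, i \in s -> j \in s -> F i z -> F j z -> i = j) ->
  (forall z, S z <-> exists2 j, j \in s & F j z) ->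
  nu S = \sum_(j <- s) nu (F j).
Proof.
move=> nuD; have nu0 : nu set0 = 0.
  have := nuD set0 set0 measurable0 measurable0 (@sub0set _ _) (@sub0set _ _) (set0I _).
  by rewrite setU0 => /eqP; rewrite -subr_eq subrr eq_sym => /eqP.
elim: s S => [|j s IH] S.
  move=> _ _ _ _ hS; rewrite big_nil; suff -> : S = set0 by [].
  by apply/seteqP; split => z // Sz; have [] := proj1 (hS z) Sz.
move=> /= /andP[js us] mF sF dF hS; rewrite big_cons.
pose S' : set (borel2 K) := \bigcup_(i in [set` s]) F i.
have S'E z : S' z <-> exists2 i, i \in s & F i z by split=> [[i si Fi]|[i si Fi]]; exists i.
have mS' : measurable S'.
  apply: fin_bigcup_measurable => [|i /= si]; first exact: finite_seq.
  by apply: mF; rewrite inE si orbT.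
have -> : S = F j `|` S'.
  apply/seteqP; split => z.
    move=> Sz; have [i + Fi] := proj1 (hS z) Sz.
  rewrite inE => /orP[/eqP e|si]; [by left; rewrite -e|right].
    by apply/S'E; exists i.
  case=> [Fj|/(proj1 (S'E z))[i si Fi]]; apply: (proj2 (hS z)); first by exists j; rewrite ?mem_head.
  by exists i; rewrite // inE si orbT.
rewrite nuD //.
- congr (_ + _); apply: IH => //.
  + by move=> i si; apply: mF; rewrite inE si orbT.
  + by move=> i si; apply: sF; rewrite inE si orbT.
  + by move=> i k z si sk; apply: dF; rewrite inE ?si ?sk orbT.
- by apply: mF; rewrite mem_head.
- by apply: sF; rewrite mem_head.
- by move=> z /S'E[i si]; apply: sF; rewrite inE si orbT.
- apply/seteqP; split => z // -[Fj /S'E[i si Fi]]; move: js.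
  by rewrite (dF j i z) ?si ?mem_head // inE si orbT.
Qed.

End Additive.

Section Haar.
Variables (K : localFieldType) (pi : K) (R : realType).
Variable mu : {measure set (borel2 K) -> \bar R}.
Hypothesis pi_unif : uniformizer pi.
Hypothesis mu_haar : normalized_haar mu.
Implicit Types (S A B : set (borel2 K)) (z w : K * K).

Local Notation q := ((residue_card K)%:R : R).
Local Notation O2 := (@integers2 K).

Definition vol S : R := fine (mu S).

Lemma integers2_saturated (N : nat) : saturated N (O2 : set (K * K)).
Proof.
move=> z w [z1 z2] [h1 h2]; split; rewrite /in_mem /=.
  by rewrite -(subrK z.1 w.1); apply: idealD z1; apply: ideal_le h1; lia.
by rewrite -(subrK z.2 w.2); apply: idealD z2; apply: ideal_le h2; lia.
Qed.

Lemma box_sub_integers2 z (a b : nat) : O2 z -> box z a b `<=` O2.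
Proof.
by move=> Oz w zw; apply: (@integers2_saturated 0) Oz _; apply: box_le zw; lia.
Qed.

Lemma measurable_box z (a b : int) : measurable (box z a b : set (borel2 K)).
Proof. by apply: (@saturated_measurable _ (Num.max a b)); apply: saturated_box; lia. Qed.

Lemma measurable_integers2 : measurable O2.
Proof. exact: saturated_measurable (@integers2_saturated 0). Qed.

Lemma mu_fin_num S : measurable S -> S `<=` O2 -> mu S \is a fin_num.
Proof.
move=> mS sS; rewrite ge0_fin_numE //; apply: (@le_lt_trans _ _ (mu O2)).
  by apply: le_measure; rewrite ?inE //; exact: measurable_integers2.
by have [-> _] := mu_haar; rewrite ltry.
Qed.

Lemma vol_additive : finitely_additive vol.
Proof.
move=> A B mA mB sA sB AB; rewrite /vol measureU //.
by rewrite fineD // mu_fin_num.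
Qed.

Lemma vol_le1 S : measurable S -> S `<=` O2 -> vol S <= 1.
Proof.
move=> mS sS; rewrite -lee_fin /vol fineK ?mu_fin_num //.
have [<- _] := mu_haar; apply: le_measure; rewrite ?inE //.
exact: measurable_integers2.
Qed.

Lemma vol_translate S S' (h : K * K) : measurable S ->
  (forall z, S' z <-> S (z - h)) -> vol S' = vol S.
Proof.
move=> mS hS; rewrite /vol; have [_ tr] := mu_haar; rewrite -(tr h S mS).
congr (fine (mu _)); apply/seteqP; split => z.
  by move=> /hS Sz; exists (z - h) => //; rewrite addrC subrK.
by move=> [w Sw <-]; apply/hS; rewrite addrC addKr.
Qed.

Lemma vol_box_translate z w (a b : int) : vol (box z a b) = vol (box w a b).
Proof.
apply: (@vol_translate _ _ (z - w)); first exact: measurable_box.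
move=> u; rewrite /box /=; have -> : u.1 - (z.1 - w.1) - w.1 = u.1 - z.1 by ring.
by have -> : u.2 - (z.2 - w.2) - w.2 = u.2 - z.2 by ring.
Qed.

Lemma q_gt0 : 0 < q.
Proof. by rewrite ltr0n; have := residue_card_gt1 K; lia. Qed.

(** A box is the disjoint union of [q] translates of the box one step smaller in a chosen
    coordinate; the normalization of [O2] then fixes all volumes. *)
Lemma vol_box z (a b : nat) : vol (box z a b) = q ^- (a + b).
Proof.
have q0 := q_gt0; have qn0 : q != 0 by lra.
suff H : q ^+ (a + b) * vol (box 0 a b) = 1.
  by rewrite (vol_box_translate z 0) -[LHS](mulKf (expf_neq0 (a + b) qn0)) H mulr1.
have [r [ru r0 rex rin] <-] := residue_reps K.
have O0 : O2 0 by split; exact: ideal0.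
have fstP (a' b' : nat) : vol (box 0 a' b') = (size r)%:R * vol (box 0 a'.+1 b').
  rewrite (@additive_partition K R vol K r
    (fun x => box (pi ^+ a' * x, 0) a'.+1 b') _ vol_additive ru).
  - rewrite (eq_bigr (fun=> vol (box 0 a'.+1 b'))) => [|x _]; last exact: vol_box_translate.
    by rewrite big_const_seq count_predT iter_addr_0 mulr_natl.
  - by move=> x _; exact: measurable_box.
  - move=> x xr; apply: box_sub_integers2; split; last exact: ideal0.
    by apply: ideal_mulr (r0 _ xr); apply: ideal_le (ideal_piX pi_unif _).
  - move=> x y w xr yr [h1 h2] [h3 h4]; apply: rin => //.
    rewrite -(ideal_piXl pi_unif _ a'); rewrite idealBC in h1.
    have /= := ideal_trans h1 h3; congr ideal; ring.
  - move=> w; split=> [[h1 h2]|[x xr [h1 h2]]]; last first.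
      split=> //=; rewrite /= in h1; rewrite subr0 -(subrK (pi ^+ a' * x) w.1).
      apply: idealD; first by apply: ideal_le h1; lia.
      by have := ideal_piXl pi_unif 0 a' x; rewrite add0r => ->; exact: r0.
    rewrite /= !subr0 in h1 h2.
    have h : ideal 0 (w.1 / pi ^+ a').
      by apply: ideal_div; rewrite ?(piX_neq0 pi_unif) // (ord_piX pi_unif) add0r.
    have [x xr hx] := rex _ h; exists x => //; split; rewrite /= ?subr0 //.
    have -> : w.1 - pi ^+ a' * x = pi ^+ a' * (w.1 / pi ^+ a' - x).
      by field; rewrite (piX_neq0 pi_unif).
    by rewrite (ideal_piXl pi_unif 1 a').
have sndP (a' b' : nat) : vol (box 0 a' b') = (size r)%:R * vol (box 0 a' b'.+1).
  rewrite (@additive_partition K R vol K r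
    (fun x => box (0, pi ^+ b' * x) a' b'.+1) _ vol_additive ru).
  - rewrite (eq_bigr (fun=> vol (box 0 a' b'.+1))) => [|x _]; last exact: vol_box_translate.
    by rewrite big_const_seq count_predT iter_addr_0 mulr_natl.
  - by move=> x _; exact: measurable_box.
  - move=> x xr; apply: box_sub_integers2; split; first exact: ideal0.
    by apply: ideal_mulr (r0 _ xr); apply: ideal_le (ideal_piX pi_unif _).
  - move=> x y w xr yr [h1 h2] [h3 h4]; apply: rin => //.
    rewrite -(ideal_piXl pi_unif _ b'); rewrite idealBC in h2.
    have /= := ideal_trans h2 h4; congr ideal; ring.
  - move=> w; split=> [[h1 h2]|[x xr [h1 h2]]]; last first.
      split=> //=; rewrite /= in h2; rewrite subr0 -(subrK (pi ^+ b' * x) w.2).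
      apply: idealD; first by apply: ideal_le h2; lia.
      by have := ideal_piXl pi_unif 0 b' x; rewrite add0r => ->; exact: r0.
    rewrite /= !subr0 in h1 h2.
    have h : ideal 0 (w.2 / pi ^+ b').
      by apply: ideal_div; rewrite ?(piX_neq0 pi_unif) // (ord_piX pi_unif) add0r.
    have [x xr hx] := rex _ h; exists x => //; split; rewrite /= ?subr0 //.
    have -> : w.2 - pi ^+ b' * x = pi ^+ b' * (w.2 / pi ^+ b' - x).
      by field; rewrite (piX_neq0 pi_unif).
    by rewrite (ideal_piXl pi_unif 1 b').
elim: a => [|a IH].
  elim: b => [|b IH]; last by rewrite addnS exprSr -mulrA -sndP.
  rewrite expr0 mul1r; have -> : (box 0 0%N 0%N : set (borel2 K)) = O2.
    by apply/seteqP; split => -[x y]; rewrite /box /integers2 /= !subr0 => -[h1 h2]; split.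
  by rewrite /vol; have [-> _] := mu_haar.
by rewrite addSn exprSr -mulrA -fstP.
Qed.

Definition grid (r : seq K) : seq (K * K) := [seq (x, y) | x <- r, y <- r].

(** The grid has exactly one point in each box of radius [N] inside [O2]; as [A] is saturated, the
    grid point of a box meeting [A] lies in [A]. The set [S] may be finer than the boxes. *)
Lemma additive_split (V : zmodType) (nu : set (borel2 K) -> V) (N : nat)
    (r : seq K) S A :
  finitely_additive nu -> is_reps N r -> saturated N A -> A `<=` O2 ->
  measurable S -> S `<=` A ->
  nu S = \sum_(z <- grid r | `[< A z >]) nu (S `&` box z N N).
Proof.
move=> nuD [ru r0 rex rin] satA sA mS sS; rewrite -big_filter.
apply: (additive_partition nuD).
- rewrite filter_uniq // /grid; apply: allpairs_uniq => //.
  by move=> [x y] [x' y'] _ _ [-> ->].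
- by move=> z _; apply: measurableI => //; exact: measurable_box.
- by move=> z _ w [Sw _]; apply/sA/sS.
- move=> i j z; rewrite !mem_filter => /andP[_ hi] /andP[_ hj] [_ [i1 i2]] [_ [j1 j2]].
  move: hi hj i1 i2 j1 j2 => /allpairsP[[x y] /= [xr yr ->]].
  move=> /allpairsP[[x' y'] /= [xr' yr' ->]] /= i1 i2 j1 j2.
  by congr pair; apply: rin => //; [apply: ideal_trans j1; rewrite idealBC|
    apply: ideal_trans j2; rewrite idealBC].
- move=> z; split=> [Sz|[w _ []//]].
  have [z1 z2] := sA _ (sS _ Sz).
  have [x xr hx] := rex _ z1; have [y yr hy] := rex _ z2.
  exists (x, y) => //; rewrite mem_filter; apply/andP; split; last first.
    by apply/allpairsP; exists (x, y).
  by apply/asboolP; apply: satA (sS _ Sz) _; apply: box_sym.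
Qed.

(* Finitely additive counterpart of the change of variables formula, for a map
   expanding every box of radius [N] in [S] by the same factors. *)
Lemma vol_image (N m1 n1 : nat) S (Psi : K * K -> K * K) :
  saturated N S -> S `<=` O2 ->
  (forall z, S z -> O2 (Psi z)) ->
  (forall z w, S z -> S w -> Psi z = Psi w -> z = w) ->
  (forall z w, S z ->
    (box (Psi z) (N + m1)%N (N + n1)%N w <-> exists2 u, box z N N u & Psi u = w)) ->
  vol [set w | exists2 z, S z & Psi z = w] = q ^- (m1 + n1) * vol S.
Proof.
move=> satS sS PsiO Psi_inj Psi_box; have [r rN _] := reps_exist pi_unif N.
have mS := saturated_measurable satS.
have [ru r0 rex rin] := rN.
rewrite (additive_split vol_additive rN satS sS mS) //.
rewrite (@additive_partition K R vol _ [seq z <- grid r | `[< S z >]]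
   (fun z => box (Psi z) (N + m1)%N (N + n1)%N) _ vol_additive).
- rewrite big_filter big_distrr; apply: eq_bigr => z /asboolP Sz /=.
  have -> : S `&` box z N N = box z N N.
    by apply/seteqP; split => w [//] h1 h2; split; [apply: satS Sz _|].
  by rewrite !vol_box -!exprVn -exprD; congr (_ ^+ _); lia.
- rewrite filter_uniq // /grid; apply: allpairs_uniq => //.
  by move=> [x y] [x' y'] _ _ [-> ->].
- by move=> z _; exact: measurable_box.
- move=> z; rewrite mem_filter => /andP[/asboolP Sz _].
  by apply: box_sub_integers2; exact: PsiO.
- move=> i j w; rewrite !mem_filter => /andP[/asboolP Si gi] /andP[/asboolP Sj gj].
  move=> /(Psi_box _ _ Si)[u iu uw] /(Psi_box _ _ Sj)[v jv vw].
  have Su := satS _ _ Si iu; have Sv := satS _ _ Sj jv.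
  have e := Psi_inj _ _ Su Sv (etrans uw (esym vw)).
  rewrite e in iu; move: gi gj iu jv => /allpairsP[[x y] /= [xr yr ->]].
  move=> /allpairsP[[x' y'] /= [xr' yr' ->]] /= [i1 i2] [j1 j2].
  by congr pair; apply: rin => //; [apply: ideal_trans j1; rewrite idealBC|
    apply: ideal_trans j2; rewrite idealBC].
- move=> w; split => [[z Sz <-]|[z]]; last first.
    rewrite mem_filter => /andP[/asboolP Sz _] /(Psi_box _ _ Sz)[u zu <-].
    by exists u => //; apply: satS Sz zu.
  have [z1 z2] := sS _ Sz.
  have [x xr hx] := rex _ z1; have [y yr hy] := rex _ z2.
  have bz : box (x, y) N N z by [].
  have Sxy : S (x, y) by apply: satS Sz _; exact: box_sym.
  exists (x, y); last by apply/Psi_box => //; exists z.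
  rewrite mem_filter; apply/andP; split; first exact/asboolP.
  by apply/allpairsP; exists (x, y).
Qed.

End Haar.

(** * Level sets on nonsingular sets *)

Section Smooth.
Variables (K : localFieldType) (pi : K) (R : realType).
Variable mu : {measure set (borel2 K) -> \bar R}.
Hypothesis pi_unif : uniformizer pi.
Hypothesis mu_haar : normalized_haar mu.
Implicit Types (A B S : set (borel2 K)) (z w : K * K) (g D : K * K -> K).

Local Notation q := ((residue_card K)%:R : R).
Local Notation O2 := (@integers2 K).
Local Notation vol := (vol mu).

Definition integral_lipschitz g :=
  (forall z, O2 z -> ideal 0 (g z)) /\
  (forall (n : nat) z w, O2 z -> box z n n w -> ideal n (g w - g z)).

Definition shift (d : K * K) (h : K) z : K * K := (z.1 + h * d.1, z.2 + h * d.2).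

(** [D] is the directional derivative of [g] along [d]; leaving the direction abstract treats [g_x]
    and [g_y] alike. *)
Definition integral_derivative g D (d : K * K) :=
  integral_lipschitz D /\
  forall z h, O2 z -> ideal 0 h ->
    exists2 r, ideal 0 r & g (shift d h z) = g z + D z * h + r * h ^+ 2.

Definition level g A (v : K) (N : int) : set (borel2 K) :=
  A `&` [set z | ideal N (g z - v)].

Lemma level_saturated g A v (N n : nat) : integral_lipschitz g ->
  (N <= n)%N -> saturated n (A : set (K * K)) -> A `<=` O2 ->
  saturated n (level g A v N).
Proof.
move=> [_ lip] Nn satA sA z w [Az hz] zw; split; first exact: satA zw.
have := lip _ _ _ (sA _ Az) zw => h; rewrite /=.
by apply: ideal_trans hz; apply: ideal_le h; lia.
Qed.

Lemma level_measurable g A v (N E : nat) : integral_lipschitz g ->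
  saturated E (A : set (K * K)) -> A `<=` O2 -> measurable (level g A v N).
Proof.
move=> lip satA sA; apply: (@saturated_measurable _ (maxn N E)).
by apply: level_saturated => //; [lia | apply: saturated_le satA; lia].
Qed.

Lemma shiftK d h z : shift d h (shift d (- h) z) = z.
Proof. by case: z => x y; rewrite /shift /=; congr pair; ring. Qed.

Lemma shift_box d h (e : int) z : ideal 0 d.1 -> ideal 0 d.2 -> ideal e h ->
  box z e e (shift d h z).
Proof.
move=> d1 d2 hh; split; rewrite /shift /= addrC addKr mulrC; exact: ideal_mulr.
Qed.

(* On a box where the derivative has constant order [b] and constant leading
   coefficient, translations by multiples of [pi ^+ (N - b)] permute the [q]
   residue subclasses of a level set. *)
Lemma smooth_box g D d z0 (e b N : nat) v :
  integral_lipschitz g -> integral_derivative g D d ->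
  ideal 0 d.1 -> ideal 0 d.2 -> O2 z0 ->
  D z0 != 0 -> ord (D z0) = b -> (b < e)%N -> (e + b <= N)%N -> (2 * b + 1 <= N)%N ->
  vol (level g (box z0 e e) v N) = q * vol (level g (box z0 e e) v N.+1).
Proof.
move=> lip [[Dint Dlip] tay] d1 d2 Oz0 D0 oD be ebN bN.
have sB : (box z0 e e : set (borel2 K)) `<=` O2 by exact: box_sub_integers2.
have satB : saturated e (box z0 e e) by apply: saturated_box.
have [r [ru r0 rex rin] <-] := residue_reps K.
(* As [D z0] has order [b], a shift by [h x] along [d] changes [g] by a unit times [pi^N x] modulo
   [pi^(N+1)]: it moves exactly one digit of the value. *)
pose h x := pi ^+ (N - b) * x.
have hI x : ideal 0 x -> ideal (N - b)%N (h x).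
  move=> hx; rewrite /h mulrC; apply: ideal_mulr => //.
  exact: ideal_piX.
have piD x : ideal 1 x -> ideal N.+1 (D z0 * (pi ^+ (N - b) * x)).
  move=> hx; have := idealM (ideal_ord (D z0)) (idealM (ideal_piX pi_unif (N - b)) hx).
  by apply: ideal_le; rewrite oD; lia.
have Dpi x : ideal N.+1 (D z0 * (pi ^+ (N - b) * x)) -> ideal 1 x.
  rewrite mulrA => hx; rewrite -(@ideal_scale _ 1 N (D z0 * pi ^+ (N - b))).
  - by apply: ideal_le hx; lia.
  - by rewrite mulf_neq0 // (piX_neq0 pi_unif).
  - by rewrite ord_mul ?(piX_neq0 pi_unif) // oD (ord_piX pi_unif); lia.
have mL v' : measurable (level g (box z0 e e) v' N.+1).
  by apply: (@level_measurable g _ _ _ e).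
rewrite (@additive_partition K R vol K r
  (fun x => level g (box z0 e e) (v + D z0 * h x) N.+1) _ (vol_additive mu_haar) ru).
- rewrite (eq_big_seq (fun=> vol (level g (box z0 e e) v N.+1))) => [|x xr].
    by rewrite big_const_seq count_predT iter_addr_0 mulr_natl.
  apply: (vol_translate mu_haar (h := (h x * d.1, h x * d.2))) => // z.
  have -> : z - (h x * d.1, h x * d.2) = shift d (- h x) z.
    by case: z => z1 z2; rewrite /shift /= !mulNr.
  have hx := hI _ (r0 _ xr).
  have hx' : ideal e (- h x) by rewrite idealN; apply: ideal_le hx; lia.
  have zB := shift_box z d1 d2 hx'.
  have Bz : box z0 e e z <-> box z0 e e (shift d (- h x) z).
    by split=> hz; apply: box_trans hz _ => //; exact: box_sym.
  suff H : box z0 e e z -> ideal N.+1 (g z - (v + D z0 * h x)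
       - (g (shift d (- h x) z) - v)).
    split=> -[hz hg].
      split; first exact/Bz.
      by rewrite /= -(subKr (g z - (v + D z0 * h x)) (g _ - v)); apply: idealB => //; exact: H.
    have hz' := proj2 Bz hz.
    split=> //; rewrite /= -(subrK (g (shift d (- h x) z) - v) (g z - _)).
    by apply: idealD => //; exact: H.
  move=> hz; set z' := shift d (- h x) z.
  have Bz' : box z0 e e z' by exact/Bz.
  have hx0 : ideal 0 (h x) by apply: ideal_le hx; lia.
  have [t t0 E] := tay z' (h x) (sB _ Bz') hx0; rewrite shiftK in E.
  (* The first term has order at least [e + (N - b) > N] because [b < e], the second at least
     [2 (N - b) > N] because [2 b + 1 <= N]. *)
  have -> : g z - (v + D z0 * h x) - (g z' - v)
     = (D z' - D z0) * h x + t * h x ^+ 2 by rewrite E; ring.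
  apply: idealD.
    by have := idealM (Dlip e z0 z' Oz0 Bz') hx; apply: ideal_le; clear -be ebN bN; lia.
  by apply: ideal_mulr => //; have := idealX 2 hx; apply: ideal_le; clear -bN; lia.
- by [].
- by move=> x _ z [/sB].
- move=> x y z xr yr [_ /= h1] [_ /= h2]; apply: rin => //; apply: Dpi.
  have := idealB h2 h1; congr ideal; rewrite /h; ring.
- move=> z; split=> [[hz /= hg]|[x xr [hz /= hg]]].
    have c0 : D z0 * pi ^+ (N - b) != 0 by rewrite mulf_neq0 // (piX_neq0 pi_unif).
    have hd : ideal 0 ((g z - v) / (D z0 * pi ^+ (N - b))).
      apply: ideal_div => //; rewrite ord_mul ?(piX_neq0 pi_unif) // oD.
      by rewrite (ord_piX pi_unif); apply: ideal_le hg; lia.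
    have [x xr hx] := rex _ hd; exists x => //; split=> //=.
    have := piD _ hx; congr ideal; rewrite /h; field.
    by move: c0; rewrite mulf_eq0 negb_or => /andP[-> ->].
  split=> //=.
  have -> : g z - v = g z - (v + D z0 * h x) + D z0 * h x by ring.
  apply: idealD; first by apply: ideal_le hg; lia.
  by have := idealM (ideal_ord (D z0)) (hI _ (r0 _ xr)); apply: ideal_le; rewrite oD; lia.
Qed.

(** On a box of radius [e > a], either [g] has order below [a] throughout, and levels near 0 miss
    the box, or a derivative has constant order [b < a] and [smooth_box] applies. The bound [N0]
    depends only on [e] and [a], hence serves all boxes at once. *)
Lemma smooth_levels g A (J : finType) (D : J -> K * K -> K) (d : J -> K * K)
    (E a : nat) :
  integral_lipschitz g -> (forall j, integral_derivative g (D j) (d j)) ->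
  (forall j, ideal 0 (d j).1 /\ ideal 0 (d j).2) ->
  saturated E (A : set (K * K)) -> A `<=` O2 ->
  (forall z, A z -> ~~ ideal a (g z) \/ exists j, ~~ ideal a (D j z)) ->
  exists N0 : nat, forall (N : nat) v, (N0 <= N)%N -> ideal N0 v ->
    vol (level g A v N) = q * vol (level g A v N.+1).
Proof.
move=> lip der dO satA sA sm; pose e := maxn E a.+1.
have satA' : saturated e (A : set (K * K)) by apply: saturated_le satA; lia.
exists (e + 2 * a + 1)%N => N v hN hv.
have [r rN _] := reps_exist pi_unif e.
have mL M : measurable (level g A v (M : nat)) by apply: (@level_measurable g _ _ _ E).
have sL M : level g A v M `<=` A by move=> z [].
rewrite !(additive_split (vol_additive mu_haar) rN satA' sA (mL _) (@sL _)).
rewrite big_distrr; apply: eq_bigr => z /asboolP Az /=.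
have LB M : level g A v M `&` box z e e = level g (box z e e) v M.
  apply/seteqP; split => [w [[_ hw] zw]|w [zw hw]] //.
  by split=> //; split => //; exact: satA' zw.
rewrite !LB; have [ng|[j nD]] := sm z Az.
  suff H M : (N <= M)%N -> level g (box z e e) v M = set0.
    rewrite !H ?leqW //.
    suff -> : vol set0 = 0 by rewrite mulr0.
    by rewrite /vol measure0.
  move=> NM; apply/seteqP; split => // w [zw /= hw].
  move/negP: ng; apply; have h := lip.2 e z w (sA _ Az) zw.
  have -> : g z = (g w - v) + v - (g w - g z) by ring.
  apply: idealB; last by apply: ideal_le h; lia.
  by apply: idealD; [apply: ideal_le hw|apply: ideal_le hv]; lia.
have [Dz0 oD] := idealNP nD.
have Dint : ideal 0 (D j z) by case: (der j) => -[h _] _; exact: h (sA _ Az).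
have [b ob] : exists b : nat, ord (D j z) = b.
  move: Dint; rewrite /ideal (negPf Dz0) /=; case: (ord (D j z)) => // b _.
  by exists b.
have [d1 d2] := dO j.
by apply: (smooth_box (b := b) _ lip (der j)) => //; rewrite ob in oD; try lia; exact: sA.
Qed.

End Smooth.

(** * Complex numbers, power series, characters *)

Section ComplexModulus.
Variable R : realType.
Implicit Types (x y z s : R[i]) (a : R).

(** The norm of [R[i]] takes values in [R[i]]; estimates and limits are carried out with this
    real-valued modulus. *)
Definition cabs z : R := ComplexField.Normc.normc z.

Lemma cabsE z : `|z| = (cabs z)%:C%C.
Proof. by []. Qed.

Lemma cabs_ge0 z : 0 <= cabs z.
Proof. by case: z => a b; rewrite /cabs /= sqrtr_ge0. Qed.

Lemma cabs0 : cabs 0 = 0.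
Proof. exact: ComplexField.Normc.normc0. Qed.

Lemma cabs1 : cabs 1 = 1.
Proof. exact: ComplexField.Normc.normc1. Qed.

Lemma cabs_eq0 z : cabs z = 0 -> z = 0.
Proof. exact: ComplexField.Normc.eq0_normc. Qed.

Lemma cabsM x y : cabs (x * y) = cabs x * cabs y.
Proof. exact: ComplexField.Normc.normcM. Qed.

Lemma cabsX x n : cabs (x ^+ n) = cabs x ^+ n.
Proof.
by elim: n => [|n IH]; rewrite ?expr0 ?cabs1 // !exprS cabsM IH.
Qed.

Lemma cabsN x : cabs (- x) = cabs x.
Proof. by case: x => a b; rewrite /cabs /= !sqrrN. Qed.

Lemma cabsD x y : cabs (x + y) <= cabs x + cabs y.
Proof. by have := ler_normD x y; rewrite !cabsE -rmorphD lecR. Qed.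

Lemma cabsB x y : cabs (x - y) <= cabs x + cabs y.
Proof. by rewrite -(cabsN y); exact: cabsD. Qed.

Lemma cabs_real a : cabs a%:C%C = `|a|.
Proof. by rewrite /cabs /= expr0n addr0 sqrtr_sqr. Qed.

Lemma Re_le_cabs z : `|complex.Re z| <= cabs z.
Proof. by case: z => a b; rewrite /cabs /= -sqrtr_sqr ler_wsqrtr // lerDl sqr_ge0. Qed.

Lemma Im_le_cabs z : `|complex.Im z| <= cabs z.
Proof. by case: z => a b; rewrite /cabs /= -sqrtr_sqr ler_wsqrtr // lerDr sqr_ge0. Qed.

Lemma cabs_le_ReIm z : cabs z <= `|complex.Re z| + `|complex.Im z|.
Proof.
case: z => a b; have -> : (a +i* b)%C = (a%:C + 'i * b%:C)%C.
  by apply/eqP; rewrite eq_complex /=; apply/andP; split; apply/eqP; ring.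
apply: le_trans (cabsD _ _) _; rewrite cabsM !cabs_real.
have -> : cabs 'i%C = 1 by rewrite /cabs /= expr0n expr1n add0r sqrtr1.
by rewrite mul1r /= !(mul0r, mul1r, subr0, addr0, add0r, mulr0).
Qed.

Lemma cpow_expr a s (n : nat) : 0 < a -> cpow (a ^+ n) s = cpow a s ^+ n.
Proof.
move=> a0; rewrite /cpow expf_eq0 (gt_eqF a0) andbF.
elim: n => [|n IH].
  rewrite !expr0 ln1 !mulr0 expR0 cos0 sin0 mulr0 mulr1 //.
rewrite [RHS]exprS -IH exprS lnM ?posrE ?exprn_gt0 // !mulrDr expRD cosD sinD.
by apply/eqP; rewrite eq_complex /=; apply/andP; split; apply/eqP; ring.
Qed.

Lemma cpowD a s y : 0 < a -> cpow a (s + y) = cpow a s * cpow a y.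
Proof.
move=> a0; rewrite /cpow (gt_eqF a0); case: s y => s1 s2 [y1 y2] /=.
rewrite !mulrDl expRD cosD sinD.
by apply/eqP; rewrite eq_complex /=; apply/andP; split; apply/eqP; ring.
Qed.

Lemma cpow0r a : 0 < a -> cpow a 0 = 1.
Proof.
by move=> a0; rewrite /cpow (gt_eqF a0) /= !mul0r expR0 cos0 sin0 mulr0 mulr1.
Qed.

Lemma cpowMn a s (n : nat) : 0 < a -> cpow a (n%:R * s) = cpow a s ^+ n.
Proof.
move=> a0; elim: n => [|n IH]; first by rewrite mul0r cpow0r.
by rewrite -addn1 natrD mulrDl mul1r cpowD // IH exprD expr1.
Qed.

Lemma cpow1r a : 0 < a -> cpow a 1 = a%:C%C.
Proof.
move=> a0; rewrite /cpow (gt_eqF a0) /= !mul0r cos0 sin0 mul1r mulr0 mulr1.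
by rewrite lnK.
Qed.

Lemma cpowN a s : 0 < a -> cpow a (- s) = (cpow a s)^-1.
Proof.
move=> a0; have H : cpow a s * cpow a (- s) = 1 by rewrite -cpowD // subrr cpow0r.
have h0 : cpow a s != 0.
  by apply/eqP => e; move: H; rewrite e mul0r => /esym/eqP; rewrite oner_eq0.
by rewrite -[LHS](mulKf h0) H mulr1.
Qed.

Lemma cpowV a s : 0 < a -> cpow a^-1 s = cpow a (- s).
Proof.
move=> a0; rewrite /cpow invr_eq0 (gt_eqF a0) lnV ?posrE //.
by case: s => s1 s2 /=; rewrite !mulrN !mulNr.
Qed.

Lemma cabs_cpow a s : 0 < a -> cabs (cpow a s) = expR (complex.Re s * ln a).
Proof.
move=> a0; rewrite /cabs /cpow (gt_eqF a0) /= !exprMn -mulrDr cos2Dsin2 mulr1.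
by rewrite sqrtr_sqr ger0_norm // expR_ge0.
Qed.

Lemma geometric_small (x C rho : R) (k0 : nat) : 0 <= rho -> rho < 1 ->
  (forall L : nat, (k0 <= L)%N -> x <= C * rho ^+ L) -> x <= 0.
Proof.
move=> r0 r1 h; have h1 : `|rho| < 1 by rewrite ger0_norm.
have : (fun L => C * rho ^+ L) @ \oo --> C * 0.
  by apply: cvgM; [exact: cvg_cst | exact: cvg_expr].
rewrite mulr0 => /cvgrPdist_lt cv; rewrite leNgt; apply/negP => x0.
have /cv [n _ hn] := x0.
have := hn (maxn n k0) (leq_maxl _ _); rewrite sub0r normrN => hlt.
have := h _ (leq_maxr n k0); have := ler_norm (C * rho ^+ maxn n k0); lra.
Qed.

(** Squaring expands near 1: [w^2 - 1 = (w - 1) (w + 1)] with [|w + 1| >= 3/2]. Along the powers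
    [z^(2^n)] the distance to 1 would outgrow [1/2] unless it is 0. *)
Lemma no_small_subgroup z : (forall n : nat, cabs (z ^+ n - 1) <= 2^-1) -> z = 1.
Proof.
move=> h; apply/eqP; rewrite -subr_eq0; apply/eqP/cabs_eq0/le_anti.
rewrite cabs_ge0 andbT; apply: (@geometric_small _ 1 (2 / 3) 0) => [||n _]; try lra.
have H : cabs (z - 1) * (3 / 2) ^+ n <= cabs (z ^+ (2 ^ n) - 1).
  elim: n => [|n IH]; first by rewrite expr0 mulr1.
  rewrite expnSr exprM; set w := z ^+ (2 ^ n) in IH *.
  have -> : w ^+ 2 - 1 = (w - 1) * (2 + (w - 1)) by ring.
  rewrite cabsM exprSr; move: IH; set v := 3 / 2; move=> IH.
  rewrite [X in X <= _]mulrA; apply: ler_pM => //.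
  - by rewrite mulr_ge0 ?cabs_ge0 // exprn_ge0 // /v; lra.
  - by rewrite /v; lra.
  - rewrite /v; have := cabsB (2 + (w - 1)) (w - 1); rewrite addrK.
    have -> : cabs 2 = 2.
      by have := cabs_real 2; rewrite rmorph_nat => ->; rewrite ger0_norm; lra.
    have := h (2 ^ n)%N; rewrite -/w; lra.
have := h (2 ^ n)%N => h2; have E : (2 / 3 : R) ^+ n * (3 / 2) ^+ n = 1.
  by rewrite -exprMn (_ : _ * _ = 1) ?expr1n //; field.
have p0 : 0 <= (2 / 3 : R) ^+ n by rewrite exprn_ge0 //; lra.
have := ler_wpM2l p0 (le_trans H h2).
by rewrite mulrCA E mulr1; lra.
Qed.

(** An explicit error rate replaces convergence to a limit, so that identities between partial sums
    transfer directly to the values. *)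
Definition power_sum (t : R[i]) (a : nat -> R[i]) (z : R[i]) :=
  exists C : R, forall L : nat,
    cabs (z - \sum_(k < L) a k * t ^+ k) <= C * cabs t ^+ L.

(** The recurrence is an exact identity between partial sums, up to initial terms. Both remainders
    are multiples of [|t|^L], whereas the difference of the two sides does not depend on [L]; hence
    it vanishes. *)
Lemma power_sum_recurrence (t : R[i]) (a b : nat -> R[i]) za zb (c : R[i])
    (l k0 : nat) : cabs t < 1 -> (forall k, (k0 <= k)%N -> b (k + l)%N = c * a k) ->
  power_sum t a za -> power_sum t b zb ->
  zb = c * t ^+ l * za + (\sum_(k < k0 + l) b k * t ^+ k
       - c * t ^+ l * \sum_(k < k0) a k * t ^+ k).
Proof.
move=> t1 rec [Ca ha] [Cb hb]; apply/eqP; rewrite -subr_eq0; apply/eqP/cabs_eq0.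
apply/le_anti; rewrite cabs_ge0 andbT.
apply: (@geometric_small _ (cabs t ^+ l * Cb + cabs c * cabs t ^+ l * Ca) (cabs t) k0).
- exact: cabs_ge0.
- exact: t1.
move=> L kL; have E : \sum_(k < L + l) b k * t ^+ k =
    \sum_(k < k0 + l) b k * t ^+ k + c * t ^+ l *
    (\sum_(k < L) a k * t ^+ k - \sum_(k < k0) a k * t ^+ k).
  elim: L kL => [|L IH]; first by rewrite leqn0 => /eqP->; rewrite subrr mulr0 addr0.
  rewrite leq_eqVlt => /orP[/eqP->|]; first by rewrite subrr mulr0 addr0.
  rewrite ltnS => kL; rewrite addSn big_ord_recr /= IH // big_ord_recr /= rec //.
  by rewrite exprD; ring.
have -> : zb - (c * t ^+ l * za + (\sum_(k < k0 + l) b k * t ^+ k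
       - c * t ^+ l * \sum_(k < k0) a k * t ^+ k)) =
   (zb - \sum_(k < L + l) b k * t ^+ k) -
   c * t ^+ l * (za - \sum_(k < L) a k * t ^+ k) by rewrite E; ring.
apply: le_trans (cabsB _ _) _; rewrite mulrDl; apply: lerD.
  apply: le_trans (hb (L + l)%N) _; rewrite le_eqVlt; apply/orP; left; apply/eqP.
  by rewrite exprD; ring.
rewrite !cabsM cabsX -[X in _ <= X]mulrA; apply: ler_wpM2l; last exact: ha.
by rewrite mulr_ge0 ?cabs_ge0 // exprn_ge0 // cabs_ge0.
Qed.

End ComplexModulus.

Section Character.
Variables (R : realType) (K : localFieldType) (chi : K -> R[i]).
Hypothesis chiP : mult_character chi.

Lemma unitsP (u : K) : (u \in @units K) = (u != 0) && (ord u == 0).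
Proof. by []. Qed.

Lemma character1 : chi 1 = 1.
Proof.
have [_ chi0 chiM _] := chiP.
have u1 : 1 \in @units K by rewrite unitsP oner_neq0 ord_one eqxx.
by apply: (mulfI (chi0 _ u1)); rewrite -chiM // !mulr1.
Qed.

Lemma characterM : {in @units K &, {morph chi : u w / u * w}}.
Proof. by have [] := chiP. Qed.

Lemma one_units (c : nat) (u : K) : (1 <= c)%N -> ideal c (u - 1) -> u \in @units K.
Proof.
move=> c1 h; have [|u0 ou] := @one_unit _ u c _ h; first by lia.
by rewrite unitsP u0 ou eqxx.
Qed.

(** By continuity [chi] maps some subgroup [1 + pi^c O] into the disc of radius [1/2] around 1.
    Powers of an element stay in the subgroup, so [no_small_subgroup] applies. *)
Lemma character_conductor : exists2 c : nat, (1 <= c)%N &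
  forall u, ideal c (u - 1) -> chi u = 1.
Proof.
have [_ _ _ /subspace_continuousP cont] := chiP.
have u1 : 1 \in @units K by rewrite unitsP oner_neq0 ord_one eqxx.
have /cvgrPdist_lt cv := cont 1 u1.
have h2 : (0 : R[i]) < 2^-1 by rewrite invr_gt0 ltr0n.
have := cv _ h2; rewrite near_withinE near_simpl => /nbhsP[E /=].
rewrite entourage_ordE => -[n _ hn] hE.
have small (u : K) : ideal (Num.max 1 n) (u - 1) -> cabs (chi u - 1) <= 2^-1.
  move=> hu; have uu : u \in @units K.
    by apply: (@one_units 1) => //; apply: ideal_le hu; lia.
  have /hE /(_ uu) : xsection E 1 u.
    rewrite /xsection /= inE; apply: hn; suff : ideal n (1 - u) by []; rewrite idealBC.
    by apply: ideal_le hu; lia.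
  move=> h; rewrite -cabsN opprB -[X in X - _]character1; apply: ltW.
  rewrite -ltcR -cabsE fmorphV rmorph_nat; exact: h.
(* The entourage only provides an integer [n]; the maximum with 1 ensures that [1 + pi^c O] consists
   of units. *)
exists (absz (Num.max 1 n)) => [|u hu]; first by lia.
have hu' : ideal (Num.max 1 n) (u - 1) by apply: ideal_le hu; lia.
have uX k : ideal (Num.max 1 n) (u ^+ k - 1) by apply: ideal_oneX => //; lia.
have units_uX k : u ^+ k \in @units K.
  by apply: (@one_units 1) => //; apply: ideal_le (uX k); lia.
apply: no_small_subgroup => k; rewrite (_ : chi u ^+ k = chi (u ^+ k)); first exact: small.
elim: k => [|k IH]; first by rewrite !expr0 character1.
by rewrite !exprS IH characterM // -[u]expr1.
Qed.

End Character.

(** * Expansion of the zeta integral *)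

Section LevelExpansion.
Variables (K : localFieldType) (pi : K) (R : realType).
Variable mu : {measure set (borel2 K) -> \bar R}.
Hypothesis pi_unif : uniformizer pi.
Hypothesis mu_haar : normalized_haar mu.
Variable chi : K -> R[i].
Hypothesis chiP : mult_character chi.
Variables (c : nat) (r : seq K).
Hypothesis c_ge1 : (1 <= c)%N.
Hypothesis chi_cond : forall u, ideal c (u - 1) -> chi u = 1.
Hypothesis rP : is_reps c r.
Variable g : K * K -> K.
Hypothesis g_lip : integral_lipschitz g.
Implicit Types (A B S : set (borel2 K)) (z w : K * K).

Local Notation q := ((residue_card K)%:R : R).
Local Notation O2 := (@integers2 K).
Local Notation vol := (vol mu).
Definition unit_reps := [seq u <- r | ~~ ideal 1 u].

(** Precision [k + c] is what determines the leading unit modulo [pi^c] of an element of order [k],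
    hence its image under [chi]. *)
Definition zeta_coef A (k : nat) : R[i] :=
  \sum_(u <- unit_reps) chi u * (vol (level g A (u * pi ^+ k) (k + c)%N))%:C%C.

Lemma q_gt1 : 1 < q.
Proof. by rewrite ltr1n residue_card_gt1. Qed.

Lemma unit_repsP u : u \in unit_reps -> [/\ u != 0, ord u = 0, ideal 0 u & u \in r].
Proof.
have [_ r0 _ _] := rP.
rewrite mem_filter => /andP[/idealNP[u0 ou] ur]; split=> //; last exact: r0.
have := r0 _ ur; rewrite /ideal (negPf u0) /=; ord_lia.
Qed.

Lemma level_ord (k : nat) u x : u \in unit_reps ->
  ideal (k + c)%N (x - u * pi ^+ k) -> x != 0 /\ ord x = k.
Proof.
move=> /unit_repsP[u0 ou _ _] h.
have v0 : u * pi ^+ k != 0 by rewrite mulf_neq0 ?(piX_neq0 pi_unif).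
have ov : ord (u * pi ^+ k) = k.
  by rewrite ord_mul ?(piX_neq0 pi_unif) // ou (ord_piX pi_unif) add0r.
rewrite -ov; apply: (ord_dominant v0 _ h).
by rewrite ov; lia.
Qed.

Variable s : R[i].
Hypothesis s_gt0 : 0 < complex.Re s.
Local Notation t := (cpow q (- s)).

Lemma cabs_t_lt1 : cabs t < 1.
Proof.
have q1 := q_gt1; have q0 : 0 < q by lra.
rewrite cabs_cpow //.
rewrite expR_lt1; case: s s_gt0 => s1 s2 /= s0.
by rewrite mulNr oppr_lt0 mulr_gt0 // ln_gt0.
Qed.

Definition integrand z : R[i] := chi (ac pi (g z)) * cpow (lnorm R (g z)) s.

Lemma integrand_level (k : nat) u z : u \in unit_reps ->
  ideal (k + c)%N (g z - u * pi ^+ k) -> integrand z = chi u * t ^+ k.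
Proof.
move=> hu h; have [x0 ox] := level_ord hu h; have [u0 ou _ _] := unit_repsP hu.
have p0 := piX_neq0 pi_unif k.
have q1 := q_gt1; have q0 : 0 < q by lra.
rewrite /integrand /lnorm (negPf x0) ox /ac ox -!exprnN; congr (_ * _).
  have -> : g z / pi ^+ k = u * (g z / (u * pi ^+ k)).
    by field; rewrite u0 p0.
  have hd : ideal c (g z / (u * pi ^+ k) - 1).
    have -> : g z / (u * pi ^+ k) - 1 = (g z - u * pi ^+ k) / (u * pi ^+ k).
      by field; rewrite u0 p0.
    apply: ideal_div; first by rewrite mulf_neq0.
    rewrite ord_mul // ou (ord_piX pi_unif) add0r.
    by apply: ideal_le h; lia.
  have uu : u \in @units K by rewrite unitsP u0 ou eqxx.
  by rewrite (characterM chiP uu (one_units c_ge1 hd)) (chi_cond hd) mulr1.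
by rewrite -exprVn cpow_expr ?invr_gt0 // cpowV.
Qed.

Lemma integrand0 z : g z = 0 -> integrand z = 0.
Proof. by move=> g0; rewrite /integrand /lnorm g0 eqxx /cpow eqxx mulr0. Qed.

Lemma level_exists z (k : nat) : g z != 0 -> ord (g z) = k ->
  exists2 u, u \in unit_reps & ideal (k + c)%N (g z - u * pi ^+ k).
Proof.
move=> g0 og; have [_ r0 rex _] := rP; have p0 := piX_neq0 pi_unif k.
have h : ideal 0 (g z / pi ^+ k).
  by apply: ideal_div; rewrite // (ord_piX pi_unif) add0r -og; exact: ideal_ord.
have [u ur hu] := rex _ h; exists u; last first.
  have -> : g z - u * pi ^+ k = pi ^+ k * (g z / pi ^+ k - u) by field.
  by rewrite addnC (ideal_piXl pi_unif c k).
rewrite mem_filter ur andbT; apply/negP => u1.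
have : ideal 1 (g z / pi ^+ k).
  by rewrite -(subrK u (g z / _)); apply: idealD u1; apply: ideal_le hu; lia.
rewrite /ideal mulf_eq0 invr_eq0 (negPf g0) (negPf p0) /=.
by rewrite ord_mul ?invr_eq0 // ordV // og (ord_piX pi_unif); lia.
Qed.

Lemma level_inj (k : nat) u u' x : u \in unit_reps -> u' \in unit_reps ->
  ideal (k + c)%N (x - u * pi ^+ k) -> ideal (k + c)%N (x - u' * pi ^+ k) -> u = u'.
Proof.
move=> /unit_repsP[_ _ _ ur] /unit_repsP[_ _ _ ur'] h h'; have [_ _ _ rin] := rP.
apply: rin => //; rewrite -(ideal_piXl pi_unif _ k).
by have := idealB h' h; congr ideal; [lia | ring].
Qed.

Lemma integrand_locally_constant z w (k : nat) : O2 z -> g z != 0 ->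
  ord (g z) = k -> box z (k + c)%N (k + c)%N w ->
  [/\ O2 w, g w != 0 & integrand w = integrand z].
Proof.
move=> Oz g0 og zw; have [u hu h] := level_exists g0 og.
have hw : ideal (k + c)%N (g w - u * pi ^+ k).
  by apply: ideal_trans h; exact: g_lip.2.
have [gw0 _] := level_ord hu hw; split=> //.
  exact: (box_sub_integers2 Oz zw).
by rewrite (integrand_level hu hw) (integrand_level hu h).
Qed.

Lemma ord_nat (x : K) : x != 0 -> ideal 0 x -> exists k : nat, ord x = k.
Proof.
by move=> x0; rewrite /ideal (negPf x0) /=; case: (ord x) => // k _; exists k.
Qed.

(** Where [g] is nonzero the integrand is locally constant, so the preimage of any set is open
    there. On the zero set of [g] it equals 0, and this set joins the preimage exactly when [P 0]
    holds. *)
Lemma integrand_measurable (P : set R[i]) :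
  measurable (O2 `&` [set z | P (integrand z)] : set (borel2 K)).
Proof.
have opens Q : measurable (O2 `&` [set z | g z != 0 /\ Q (integrand z)] : set (borel2 K)).
  apply: sub_sigma_algebra; apply: locally_box_open => z [Oz [g0 Qz]].
  have [k ok] := ord_nat g0 (g_lip.1 _ Oz).
  exists (k + c)%N => w zw.
  by have [? ? e] := integrand_locally_constant Oz g0 ok zw; rewrite /= e.
rewrite (_ : _ `&` _ = (O2 `&` [set z | g z != 0 /\ P (integrand z)]) `|`
  (if `[< P 0 >] then O2 `\` (O2 `&` [set z | g z != 0 /\ True]) else set0)).
  apply: measurableU; first exact: opens.
  case: ifP => _; last exact: measurable0.
  by apply: measurableD; [exact: measurable_integers2 | exact: (opens (fun=> True))].
apply/seteqP; split=> z.
  move=> [Oz Pz]; have [g0|g0] := eqVneq (g z) 0; last by left.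
  right; rewrite /= integrand0 // in Pz.
  by case: asboolP => // _; split=> // -[_ [+ _]]; rewrite g0 eqxx.
case=> [[Oz [_ Pz]] //|]; case: asboolP => // P0 [Oz nz]; split=> //=.
have [g0|g0] := eqVneq (g z) 0; first by rewrite integrand0.
by case: nz.
Qed.

(** On units [chi] takes only its values on [unit_reps], so the sum of their moduli is a bound
    obtained without showing that [chi] is unitary. *)
Definition chi_bound : R := \sum_(u <- unit_reps) cabs (chi u).

Lemma chi_bound_ge0 : 0 <= chi_bound.
Proof. by apply: sumr_ge0 => u _; exact: cabs_ge0. Qed.

Lemma integrand_bound z (L : nat) : O2 z -> ideal L (g z) ->
  cabs (integrand z) <= chi_bound * cabs t ^+ L.
Proof.
move=> Oz hL; have t1 := cabs_t_lt1; have t0 := cabs_ge0 t.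
have B0 : 0 <= chi_bound * cabs t ^+ L by rewrite mulr_ge0 ?chi_bound_ge0 ?exprn_ge0.
have [g0|g0] := eqVneq (g z) 0; first by rewrite integrand0 // cabs0.
have [k ok] := ord_nat g0 (g_lip.1 _ Oz).
have [u hu h] := level_exists g0 ok.
rewrite (integrand_level hu h) cabsM cabsX; apply: ler_pM.
- exact: cabs_ge0.
- exact: exprn_ge0.
- rewrite /chi_bound (big_rem u) //= lerDl.
  by apply: sumr_ge0 => v _; exact: cabs_ge0.
apply: ler_wiXn2l => //; first exact: ltW.
by move: hL; rewrite /ideal (negPf g0) ok.
Qed.

Lemma integrand_integrable (phi : R[i] -> R) A : (forall x, `|phi x| <= cabs x) ->
  measurable A -> A `<=` O2 ->
  mu.-integrable A (EFin \o (fun z => phi (integrand z))).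
Proof.
move=> hphi mA sA; apply: (@integrableS _ _ _ mu O2) => //.
  exact: measurable_integers2.
apply: measurable_bounded_integrable; first exact: measurable_integers2.
- by have [-> _] := mu_haar; rewrite ltry.
- by move=> _ Y mY; exact: (integrand_measurable (fun x => Y (phi x))).
exists chi_bound; split; first exact: num_real.
move=> M hM z Oz; apply: le_trans (ltW hM); apply: le_trans (hphi _) _.
have := @integrand_bound z 0 Oz; rewrite expr0 mulr1; apply; exact: g_lip.1.
Qed.

Definition zeta A : R[i] := cintegral mu A integrand.

Lemma zeta_additive : finitely_additive zeta.
Proof.
move=> A B mA mB sA sB AB.
have H (phi : R[i] -> R) : (forall x, `|phi x| <= cabs x) ->
    Rintegral mu (A `|` B) (fun z => phi (integrand z)) =
    Rintegral mu A (fun z => phi (integrand z)) +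
    Rintegral mu B (fun z => phi (integrand z)).
  move=> hphi; apply: Rintegral_setU => //.
    by apply: integrand_integrable => //; [exact: measurableU|move=> z [/sA|/sB]].
  by apply/eqP; rewrite AB.
rewrite /zeta /cintegral (H _ (@Re_le_cabs R)) (H _ (@Im_le_cabs R)).
by apply/eqP; rewrite eq_complex /= !eqxx.
Qed.

Lemma zeta_level (A : set (borel2 K)) (k : nat) u : u \in unit_reps ->
  measurable (level g A (u * pi ^+ k) (k + c)%N) ->
  zeta (level g A (u * pi ^+ k) (k + c)%N) =
  chi u * (vol (level g A (u * pi ^+ k) (k + c)%N))%:C%C * t ^+ k.
Proof.
move=> hu; set S := level _ _ _ _ => mS.
have H (phi : R[i] -> R) : Rintegral mu S (fun z => phi (integrand z)) =
    phi (chi u * t ^+ k) * vol S.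
  rewrite -(Rintegral_cst mu mS); apply: eq_Rintegral => z.
  by rewrite inE => -[_ hz]; rewrite (integrand_level hu hz).
rewrite /zeta /cintegral !H mulrAC; case: (chi u * _) => x y.
by apply/eqP; rewrite eq_complex /=; apply/andP; split; apply/eqP; ring.
Qed.

(** Real and imaginary parts are bounded separately, whence the factor 2; the volume of [A] is at
    most 1. *)
Lemma zeta_tail A (L : nat) : measurable A -> A `<=` O2 ->
  (forall z, A z -> ideal L (g z)) ->
  cabs (zeta A) <= 2 * chi_bound * cabs t ^+ L.
Proof.
move=> mA sA hA.
have H (phi : R[i] -> R) : (forall x, `|phi x| <= cabs x) ->
    `|Rintegral mu A (fun z => phi (integrand z))| <= chi_bound * cabs t ^+ L.
  move=> hphi; have iA := integrand_integrable hphi mA sA.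
  apply: le_trans (le_normr_Rintegral mA iA) _.
  apply: (@le_trans _ _ (Rintegral mu A (cst (chi_bound * cabs t ^+ L)))).
    apply: le_Rintegral => //.
    - exact: (integrable_norm iA).
    - apply: measurable_bounded_integrable => //.
      + by rewrite -ge0_fin_numE // (mu_fin_num mu_haar).
      + exact: bounded_cst.
    - move=> z Az; apply: le_trans (hphi _) _.
      by apply: integrand_bound; [exact: sA | exact: hA].
  rewrite Rintegral_cst // -[X in _ <= X]mulr1; apply: ler_wpM2l.
    by rewrite mulr_ge0 ?chi_bound_ge0 // exprn_ge0 // cabs_ge0.
  exact: vol_le1.
apply: le_trans (cabs_le_ReIm _) _.
have := H _ (@Re_le_cabs R); have := H _ (@Im_le_cabs R).
by rewrite /zeta /cintegral /=; lra.
Qed.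

(** Removing the layers where [g] has order [0, ..., L - 1] leaves exactly the integral over
    [level g A 0 L], which [zeta_tail] bounds. Each layer splits according to the leading unit
    modulo [pi^c]. *)
Lemma zeta_expansion A (E : nat) : saturated E (A : set (K * K)) -> A `<=` O2 ->
  power_sum t (zeta_coef A) (zeta A).
Proof.
move=> satA sA; exists (2 * chi_bound) => L.
have mL v (N : nat) : measurable (level g A v N) by apply: (@level_measurable _ g _ _ _ E).
have sL v N : level g A v N `<=` O2 by move=> z [/sA].
have -> : zeta A - \sum_(k < L) zeta_coef A k * t ^+ k = zeta (level g A 0 L).
  apply/eqP; rewrite subr_eq; apply/eqP; elim: L => [|L IH].
    rewrite big_ord0 addr0; congr zeta; apply/seteqP; split=> z; last by case.
    by move=> Az; split=> //=; rewrite subr0; apply: g_lip.1; exact: sA.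
  rewrite IH big_ord_recr /= addrA [RHS]addrAC; congr (_ + _).
  have <- : level g A 0 L.+1 `|` (level g A 0 L `\` level g A 0 L.+1) = level g A 0 L.
    rewrite setDE; apply/seteqP; split=> z.
      by case=> [[Az h]|[]//]; split=> //=; apply: ideal_le h; lia.
    by move=> h; case: (pselect (level g A 0 L.+1 z)); [left|right].
  rewrite zeta_additive //.
  - congr (_ + _).
    rewrite /zeta_coef mulr_suml.
    rewrite (@additive_partition K _ zeta K unit_reps
      (fun u => level g A (u * pi ^+ L) (L + c)%N) _ zeta_additive).
    + by apply: eq_big_seq => u hu; rewrite zeta_level.
    + by apply: filter_uniq; case: rP.
    + by move=> u _; exact: mL.
    + by move=> u _; exact: sL.
    + by move=> u u' z hu hu' [_ /= h] [_ /= h']; exact: level_inj h h'.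
    + move=> z; split=> [[[Az /= h] n]|[u hu [Az h]]].
        have nL1 : ~~ ideal L.+1 (g z).
          by apply/negP => h'; apply: n; split=> //=; rewrite subr0.
        have [g0 og] := idealNP nL1; rewrite subr0 /ideal (negPf g0) /= in h.
        have oL : ord (g z) = L by ord_lia.
        by have [u hu hz] := level_exists g0 oL; exists u.
      have [g0 og] := level_ord hu h; split.
        by split=> //=; rewrite subr0 /ideal (negPf g0) og /=.
      by move=> [_ /=]; rewrite subr0 /ideal (negPf g0) og /=; lia.
  - exact: measurableD.
  - by move=> z [/sL].
  - by rewrite setDE setIA [_ `&` level g A 0 L]setIC -setIA setICr setI0.
apply: zeta_tail => //.
by move=> z [_ /=]; rewrite subr0.
Qed.

End LevelExpansion.

(** * Rescaling near a singular point *)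

Section NearOne.
Variables (K : localFieldType) (e e1 c : nat).
Hypothesis c_ge1 : (1 <= c)%N.
Implicit Types (phi psi : K -> K) (t : K).

(* The loss [e1] in the Lipschitz condition is harmless: in [dilation] the
   function multiplies a coordinate lying in [pi^e O] with [e1 <= e]. *)
Definition near_one phi :=
  (forall t, ideal e t -> ideal c (phi t - 1)) /\
  (forall t t' (j : nat), ideal e t -> ideal e t' -> ideal j (t - t') ->
     ideal (j%:Z - e1%:Z) (phi t - phi t')).

Lemma near_one_unit phi t : near_one phi -> ideal e t -> phi t != 0 /\ ord (phi t) = 0.
Proof. by move=> [h _] et; apply: (@one_unit _ _ c); [lia | exact: h]. Qed.

Lemma near_one_int phi t : near_one phi -> ideal e t -> ideal 0 (phi t).
Proof. by move=> h et; have [_ o] := near_one_unit h et; have := ideal_ord (phi t); rewrite o. Qed.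

Lemma near_oneM phi psi : near_one phi -> near_one psi ->
  near_one (fun t => phi t * psi t).
Proof.
move=> h1 h2; split=> [t et|t t' j et et' tt'].
  by apply: ideal_oneM; [lia | exact: h1.1 | exact: h2.1].
have -> : phi t * psi t - phi t' * psi t' =
  psi t * (phi t - phi t') + phi t' * (psi t - psi t') by ring.
apply: idealD; apply: ideal_mulr; [exact: near_one_int|exact: h1.2|
  exact: near_one_int|exact: h2.2].
Qed.

Lemma near_oneV phi : near_one phi -> near_one (fun t => (phi t)^-1).
Proof.
move=> h; split=> [t et|t t' j et et' tt'].
  have [p0 o] := near_one_unit h et; rewrite -(ideal_unitl _ _ p0 o).
  by rewrite mulrBr mulfV // mulr1 idealBC; exact: h.1.
have [p0 o] := near_one_unit h et; have [p0' o'] := near_one_unit h et'.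
rewrite -(ideal_unitl _ _ p0 o) -(ideal_unitl _ _ p0' o').
have -> : phi t' * (phi t * ((phi t)^-1 - (phi t')^-1)) = - (phi t - phi t').
  by field; rewrite p0 p0'.
by rewrite idealN; exact: h.2.
Qed.

Lemma near_one1 : near_one (fun=> 1).
Proof. by split=> *; rewrite subrr ideal0. Qed.

Lemma near_oneX phi n : near_one phi -> near_one (fun t => phi t ^+ n).
Proof.
move=> h; elim: n => [|n IH].
  by under [X in near_one X]funext => t do rewrite expr0; exact: near_one1.
by under [X in near_one X]funext => t do rewrite exprS; exact: near_oneM.
Qed.

Lemma near_one_prod (J : finType) (P : pred J) (F : J -> K -> K) :
  (forall j, P j -> near_one (F j)) -> near_one (fun t => \prod_(j | P j) F j t).
Proof.
(* The pointwise product is rewritten as an iterated product of functions, so that induction on the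
   product can carry [near_one]. *)
move=> h; rewrite (_ : (fun _ => _) = (fun t =>
    (\big[(fun a b => fun t => a t * b t)/(fun=> 1)]_(j | P j) F j) t)).
  elim/big_ind: _ => [|a b ha hb|j /h //]; first exact: near_one1.
  exact: near_oneM.
apply/funext => t; elim/big_rec2: _ => // j a b _ <-; by [].
Qed.

(** Multiplication by [beta] sends [pi^e O] into [pi^(e - e1) O], hence into [pi^c O]; this dictates
    the radius [e1 + c]. *)
Lemma near_one_affine (beta : K) : (e1 + c <= e)%N ->
  ideal (- e1%:Z) beta -> near_one (fun t => 1 + t * beta).
Proof.
move=> ece hb; split=> [t et|t t' j et et' tt'].
  by rewrite addrC addKr; apply: ideal_le (idealM et hb); lia.
have -> : 1 + t * beta - (1 + t' * beta) = (t - t') * beta by ring.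
exact: idealM tt' hb.
Qed.

End NearOne.

Section Scaling.
Variables (K : localFieldType) (pi : K) (R : realType).
Variable mu : {measure set (borel2 K) -> \bar R}.
Hypothesis pi_unif : uniformizer pi.
Hypothesis mu_haar : normalized_haar mu.
Variables (p : nat) (charK : p \in [pchar K]).
Variables (c e e1 m nu m1 n1 l : nat) (f : {poly K}) (gam : K) (H u : K -> K).
Hypothesis c_ge1 : (1 <= c)%N.
Hypothesis e1_le : (e1 <= e)%N.
Hypothesis m_gt0 : (0 < m)%N.
Hypothesis p_ndvd_m : ~~ (p %| m)%N.
Hypothesis gam_int : ideal 0 gam.
Hypothesis u_near : near_one e e1 c u.
Hypothesis fH : forall t, f.[gam + t] = t ^+ nu * H t.
Hypothesis Hu : forall t, ideal e t -> H (pi ^+ m1 * t) = u t * H t.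
Hypothesis nu_m1 : (nu * m1 = l)%N.
Hypothesis n1_m : (n1 * m = l)%N.

Let g := fun z : K * K => z.2 ^+ m - f.[z.1].
Hypothesis g_lip : integral_lipschitz g.

Local Notation q := ((residue_card K)%:R : R).
Local Notation O2 := (@integers2 K).
Local Notation vol := (vol mu).

Definition dilation (w : K -> K) (z : K * K) : K * K :=
  (gam + pi ^+ m1 * (z.1 - gam), pi ^+ n1 * (w (z.1 - gam) * z.2)).

Lemma sub_box_int (e' e'' : nat) : box (gam, 0) e' e'' `<=` (O2 : set (K * K)).
Proof. by apply: box_sub_integers2; split => //; exact: ideal0. Qed.

(** The map is triangular: solving for the first coordinate makes [w] a known unit, and the second
    coordinate follows by division. The condition [e <= j] keeps the preimage where [w] is
    controlled. *)
Lemma dilation_box w z (j : nat) (z' : K * K) : near_one e e1 c w -> (e <= j)%N ->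
  box (gam, 0) e e z ->
  (box (dilation w z) (j + m1)%N (j + n1)%N z' <->
   exists2 x, box z j j x & dilation w x = z').
Proof.
move=> hw ej [z1 z2]; rewrite /= subr0 in z1 z2.
have pm := piX_neq0 pi_unif m1; have pn := piX_neq0 pi_unif n1.
have move1 (x : K) : ideal j (x - z.1) -> ideal e (x - gam).
  by move=> hx; apply: ideal_trans z1; apply: ideal_le hx; clear -ej; lia.
have cross (x : K) : ideal j (x - z.1) ->
    ideal j ((w (x - gam) - w (z.1 - gam)) * z.2).
  move=> hx; have h : ideal j ((x - gam) - (z.1 - gam)) by rewrite opprB addrA subrK.
  have := idealM (hw.2 _ _ j (move1 _ hx) z1 h) z2.
  by apply: ideal_le; clear -e1_le ej; lia.
split=> [[h1 h2]|[x [x1 x2] <-]]; last first.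
  split=> /=.
    have -> : gam + pi ^+ m1 * (x.1 - gam) - (gam + pi ^+ m1 * (z.1 - gam))
      = pi ^+ m1 * (x.1 - z.1) by ring.
    by rewrite (ideal_piXl pi_unif j m1).
  have -> : pi ^+ n1 * (w (x.1 - gam) * x.2) - pi ^+ n1 * (w (z.1 - gam) * z.2)
    = pi ^+ n1 * (w (x.1 - gam) * (x.2 - z.2) + (w (x.1 - gam) - w (z.1 - gam)) * z.2).
    by ring.
  rewrite (ideal_piXl pi_unif j n1); apply: idealD; last exact: cross.
  by apply: ideal_mulr => //; apply: (near_one_int c_ge1 hw); exact: move1.
rewrite /= in h1 h2.
pose x1 := gam + (z'.1 - gam) / pi ^+ m1.
have hx1 : ideal j (x1 - z.1).
  rewrite -(ideal_piXl pi_unif j m1).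
  by move: h1; congr ideal; rewrite /x1; field.
have [w0 ow] := near_one_unit c_ge1 hw (move1 _ hx1).
exists (x1, z'.2 / (pi ^+ n1 * w (x1 - gam))).
  split=> //=; rewrite -(ideal_unitl _ _ w0 ow).
  have -> : w (x1 - gam) * (z'.2 / (pi ^+ n1 * w (x1 - gam)) - z.2) =
     (z'.2 - pi ^+ n1 * (w (z.1 - gam) * z.2)) / pi ^+ n1
     - (w (x1 - gam) - w (z.1 - gam)) * z.2.
    by field; rewrite pn w0.
  apply: idealB; last exact: cross.
  by apply: ideal_div => //; rewrite (ord_piX pi_unif).
rewrite [RHS]surjective_pairing /dilation /=; congr pair; first by rewrite /x1; field.
by field; rewrite pn w0.
Qed.

Lemma dilation_inj w z z' : near_one e e1 c w ->
  box (gam, 0) e e z -> dilation w z = dilation w z' -> z = z'.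
Proof.
move=> hw [z1 _] []; rewrite /= in z1.
have pm := piX_neq0 pi_unif m1; have pn := piX_neq0 pi_unif n1.
have [w0 _] := near_one_unit c_ge1 hw z1.
move=> /addrI /(mulfI pm) E; rewrite -E => /(mulfI pn) /(mulfI w0) E2.
by case: z z' E E2 z1 w0 => a b [a' b'] /= /addIr -> ->.
Qed.

(* Modulo [pi ^+ k] a principal unit has an [m]-th root that is one of its own
   powers, since the group of principal units is pro-[p] and [p] does not
   divide [m]. *)
Lemma approximate_root (k : nat) : exists a : nat, forall x : K,
  ideal 1 (x - 1) -> exists2 eps, ideal k eps & (x ^+ a) ^+ m = x * (1 + eps).
Proof.
have pp : prime p by exact: pcharf_prime charK.
have cop : coprime m (p ^ k) by rewrite coprime_sym coprimeXl // prime_coprime.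
(* Bezout: [a m = b p^k + 1], so [x^(a m)] is [x] times the error factor [(x^(p^k))^b]. *)
have [a b E _] := egcdnP (p ^ k) m_gt0; rewrite (eqP cop) in E.
exists a => x hx; exists ((x ^+ (p ^ k)) ^+ b - 1); last first.
  by rewrite addrC subrK -!exprM E addn1 exprS mulnC.
apply: ideal_oneX => //.
(* The Frobenius turns the error into a [p^k]-th power of [x - 1], of order at least [p^k >= k]. *)
have -> : x ^+ (p ^ k) - 1 = (x - 1) ^+ (p ^ k).
  elim: k {cop E} => [|k IH]; first by rewrite expn0 !expr1.
  by rewrite expnSr !exprM -IH -!(pFrobenius_autE charK) rmorphB rmorph1.
have := idealX (p ^ k) hx; rewrite mulr1; apply: ideal_le.
by rewrite lez_nat ltnW // ltn_expl // prime_gt1.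
Qed.

(** With [w = u^a] one gets [g (dilation w z) = pi^l u (g z + eps y^m)]. Here [eps] vanishes modulo
    [pi^(k+c)], and [u] is 1 modulo [pi^c], so it does not affect a value of order at least [k] at
    this precision. The function [w] may depend on [k]. *)
Lemma dilation_level (k : nat) (v : K) : ideal 0 v -> exists2 w, near_one e e1 c w &
  forall z, box (gam, 0) e e z ->
    (ideal (k + c)%N (g z - v * pi ^+ k) <->
     ideal (k + l + c)%N (g (dilation w z) - v * pi ^+ (k + l))).
Proof.
move=> v0; have [a ha] := approximate_root (k + c).
exists (fun t => u t ^+ a); first exact: near_oneX.
move=> z [z1 z2]; rewrite /= subr0 in z1 z2; set t := z.1 - gam in z1.
have [u0 ou] := near_one_unit c_ge1 u_near z1.
have hu1 := u_near.1 _ z1.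
have hu2 : ideal 1 (u t - 1) by apply: ideal_le hu1; clear -c_ge1; lia.
have [eps heps E] := ha (u t) hu2.
set X := g z + eps * z.2 ^+ m.
have gX : g (dilation (fun t => u t ^+ a) z) = pi ^+ l * (u t * X).
  have fz : f.[z.1] = t ^+ nu * H t by rewrite -fH /t addrC subrK.
  rewrite /X /g /dilation /= -/t fz fH Hu // !exprMn E -!exprM.
  by rewrite (mulnC m1 nu) nu_m1 n1_m; ring.
rewrite gX exprD.
have -> : pi ^+ l * (u t * X) - v * (pi ^+ k * pi ^+ l) =
  pi ^+ l * (u t * X - v * pi ^+ k) by ring.
rewrite (_ : (k + l + c)%N = (k + c + l)%N); last by clear; lia.
rewrite (ideal_piXl pi_unif (k + c)%N l).
have hX : ideal (k + c)%N (X - g z).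
  rewrite /X addrC addKr mulrC; apply: ideal_mulr => //; apply: idealX0.
  by apply: ideal_le z2; clear; lia.
have vk : ideal k (v * pi ^+ k) by apply: ideal_mulr => //; exact: ideal_piX.
have uX : ideal k X -> ideal (k + c)%N (u t * X - X).
  move=> h; have -> : u t * X - X = (u t - 1) * X by ring.
  by have := idealM hu1 h; apply: ideal_le; clear; lia.
split=> [hg|hg].
  have hXv : ideal (k + c)%N (X - v * pi ^+ k) by exact: ideal_trans hX hg.
  apply: (ideal_trans _ hXv); apply: uX; rewrite -(subrK (v * pi ^+ k) X).
  by apply: idealD vk; apply: ideal_le hXv; clear; lia.
have kX : ideal k X.
  rewrite -(ideal_unitl _ _ u0 ou) -(subrK (v * pi ^+ k) (u t * X)).
  by apply: idealD vk; apply: ideal_le hg; clear; lia.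
apply: ideal_trans hg; rewrite idealBC.
by apply: ideal_trans hX; exact: uX.
Qed.

Lemma vol_level_dilation (k : nat) (v : K) : ideal 0 v ->
  vol (level g (box (gam, 0) (e + m1)%N (e + n1)%N) (v * pi ^+ (k + l)) (k + l + c)%N) =
  q ^- (m1 + n1) * vol (level g (box (gam, 0) e e) (v * pi ^+ k) (k + c)%N).
Proof.
move=> v0; have [w hw hlev] := dilation_level k v0.
(* [N >= e] is required by [dilation_box], and [N >= k + c] makes the level set saturated. *)
pose N := maxn e (k + c); pose S := level g (box (gam, 0) e e) (v * pi ^+ k) (k + c)%N.
have sO : (box (gam, 0) e e : set (borel2 K)) `<=` O2 by exact: sub_box_int.
have satS : saturated N S.
  apply: level_saturated => //; first by lia.
  by apply: saturated_box; lia.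
(* Because the centre is fixed, [dilation_box] applied there identifies the image of the
   neighbourhood with the smaller box. *)
have gamE : dilation w (gam, 0) = (gam, 0).
  by rewrite /dilation /= subrr !mulr0 addr0.
have cen : box (gam, 0) e e (gam, 0) by exact: box_refl.
have Psi_box z' : box (gam, 0) (e + m1)%N (e + n1)%N z' <->
    exists2 x, box (gam, 0) e e x & dilation w x = z'.
  by rewrite -{1}gamE; exact: dilation_box.
rewrite -(vol_image pi_unif mu_haar (N := N) (m1 := m1) (n1 := n1) (S := S)
  (Psi := dilation w)) //.
- congr vol; apply/seteqP; split=> z'.
    move=> [/Psi_box[z zN <-] hz]; exists z => //; split=> //.
    by apply/hlev.
  move=> [z [zN hz] <-]; split; first by apply/Psi_box; exists z.
  by apply/(hlev z zN).
- by move=> z [/sO].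
- move=> z [zN _]; apply: (sub_box_int (e' := e + m1) (e'' := e + n1)).
  by apply/Psi_box; exists z.
- by move=> z z' [zN _] [zN' _]; exact: dilation_inj.
- by move=> z z' [zN _]; apply: dilation_box => //; rewrite /N; lia.
Qed.

End Scaling.

(** * The polynomial [y^m - f(x)] *)

Section Superelliptic.
Variables (K : localFieldType) (f : {poly K}) (m : nat).
Hypothesis f_int : forall i, ideal 0 f`_i.
Local Notation O2 := (@integers2 K).

Lemma poly_int (P : {poly K}) x : (forall i, ideal 0 P`_i) -> ideal 0 x ->
  ideal 0 P.[x].
Proof.
move=> hP hx; rewrite horner_coef; elim/big_ind: _ => [|a b|i _].
- exact: ideal0.
- exact: idealD.
- by apply: ideal_mulr => //; exact: idealX0.
Qed.

Lemma deriv_int (P : {poly K}) : (forall i, ideal 0 P`_i) -> forall i, ideal 0 P^`()`_i.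
Proof.
move=> hP i; rewrite coef_deriv -mulr_natl; apply: ideal_mulr => //.
exact: ideal_nat.
Qed.

Lemma poly_lipschitz (P : {poly K}) (n : nat) x y : (forall i, ideal 0 P`_i) ->
  ideal 0 x -> ideal n (y - x) -> ideal n (P.[y] - P.[x]).
Proof.
move=> hP hx hn; have h0 : ideal 0 (y - x) by apply: ideal_le hn.
have [r r0] := poly_taylor hP hx h0; rewrite addrC subrK => ->.
have -> : P.[x] + P^`().[x] * (y - x) + r * (y - x) ^+ 2 - P.[x] =
  P^`().[x] * (y - x) + r * (y - x) ^+ 2 by ring.
apply: idealD.
  by apply: ideal_mulr => //; apply: poly_int => //; exact: deriv_int.
by apply: ideal_mulr => //; rewrite expr2; apply: ideal_mulr.
Qed.

Lemma Xn_int i : ideal 0 ('X^m : {poly K})`_i.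
Proof. by rewrite coefXn; case: eqP => _; [exact: ideal1 | exact: ideal0]. Qed.

Definition superelliptic (z : K * K) : K := z.2 ^+ m - f.[z.1].
Definition deriv_x (z : K * K) : K := - f^`().[z.1].
Definition deriv_y (z : K * K) : K := ('X^m : {poly K})^`().[z.2].

Lemma superellipticE z : superelliptic z = ('X^m).[z.2] - f.[z.1].
Proof. by rewrite hornerXn. Qed.

Lemma superelliptic_lipschitz : integral_lipschitz superelliptic.
Proof.
split=> [z [z1 z2]|n z w [z1 z2] [w1 w2]]; rewrite !superellipticE.
  by apply: idealB; apply: poly_int => //; exact: Xn_int.
have -> : ('X^m).[w.2] - f.[w.1] - (('X^m).[z.2] - f.[z.1]) =
  (('X^m).[w.2] - ('X^m).[z.2]) - (f.[w.1] - f.[z.1]) by ring.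
by apply: idealB; apply: poly_lipschitz => //; exact: Xn_int.
Qed.

Lemma deriv_x_derivative : integral_derivative superelliptic deriv_x (1, 0).
Proof.
split.
  split=> [z [z1 z2]|n z w [z1 z2] [w1 w2]].
    by rewrite /deriv_x idealN; apply: poly_int => //; exact: deriv_int.
  rewrite /deriv_x -opprD idealN; apply: poly_lipschitz => //; exact: deriv_int.
move=> z h [z1 z2] h0; have [r r0 E] := poly_taylor f_int z1 h0.
exists (- r); first by rewrite idealN.
by rewrite /superelliptic /shift /deriv_x /= mulr1 mulr0 addr0 E; ring.
Qed.

Lemma deriv_y_derivative : integral_derivative superelliptic deriv_y (0, 1).
Proof.
split.
  split=> [z [z1 z2]|n z w [z1 z2] [w1 w2]].
    by apply: poly_int => //; apply: deriv_int; exact: Xn_int.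
  by apply: poly_lipschitz => //; apply: deriv_int; exact: Xn_int.
move=> z h [z1 z2] h0; have [r r0 E] := poly_taylor Xn_int z2 h0.
exists r => //.
by rewrite !superellipticE /shift /deriv_y /= mulr1 mulr0 addr0 E; ring.
Qed.

Variables (k : nat) (gamma0 : K) (gamma : 'I_k -> K) (nu : 'I_k -> nat).
Hypothesis gamma0_neq0 : gamma0 != 0.
Hypothesis gamma_inj : injective gamma.
Hypothesis nu_ge1 : forall i, (1 <= nu i)%N.
Hypothesis f_split : f = gamma0 *: \prod_(i < k) ('X - (gamma i)%:P) ^+ nu i.
Hypothesis m_ge2 : (2 <= m)%N.
Hypothesis m_neq0 : m%:R != 0 :> K.

Definition cofactor_at i t : K :=
  gamma0 * \prod_(j < k | j != i) (gamma i + t - gamma j) ^+ nu j.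

Lemma horner_f x : f.[x] = gamma0 * \prod_(j < k) (x - gamma j) ^+ nu j.
Proof.
rewrite f_split hornerZ horner_prod; congr (_ * _); apply: eq_bigr => j _.
by rewrite horner_exp hornerXsubC.
Qed.

Lemma horner_root i t : f.[gamma i + t] = t ^+ nu i * cofactor_at i t.
Proof.
rewrite horner_f (bigD1 i) //= /cofactor_at addrC addKr.
by rewrite mulrCA; congr (_ * (_ * _)); apply: eq_bigr => j _; rewrite addrC.
Qed.

Lemma gamma_sub_neq0 i j : j != i -> gamma i - gamma j != 0.
Proof. by move=> ji; rewrite subr_eq0 eq_sym; apply: contra ji => /eqP/gamma_inj->. Qed.

(** Dividing each factor [gamma_i + t - gamma_j] by [gamma_i - gamma_j] turns the ratio of cofactors
    into a product of functions within reach of [near_one_affine]. *)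
Lemma cofactor_at_scale i (a u : K) t :
  (forall j, j != i -> 1 + t * (gamma i - gamma j)^-1 != 0) ->
  u = \prod_(j < k | j != i)
    ((1 + t * (a * (gamma i - gamma j)^-1)) * (1 + t * (gamma i - gamma j)^-1)^-1) ^+ nu j ->
  cofactor_at i (a * t) = u * cofactor_at i t.
Proof.
move=> nz ->; rewrite /cofactor_at mulrCA -big_split /=; congr (_ * _).
apply: eq_bigr => j ji; rewrite -exprMn; congr (_ ^+ _).
have d0 := gamma_sub_neq0 ji; have := nz j ji.
have -> : 1 + t / (gamma i - gamma j) = (gamma i + t - gamma j) / (gamma i - gamma j).
  by field.
rewrite mulf_eq0 negb_or => /andP[n0 _].
by field; rewrite n0 d0.
Qed.

Lemma deriv_simple_root i : nu i = 1%N -> f^`().[gamma i] != 0.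
Proof.
move=> ni; rewrite f_split (bigD1 i) //= ni expr1 derivZ derivM derivXsubC mul1r.
rewrite hornerZ hornerD hornerM hornerXsubC subrr mul0r addr0 horner_prod.
rewrite mulf_neq0 //; apply/prodf_neq0 => j ji.
by rewrite horner_exp hornerXsubC expf_neq0 // gamma_sub_neq0.
Qed.

(** An explicit case analysis takes the place of compactness. If [y] is not small, [m y^(m-1)] has
    bounded order. If [y] is small and [x] is near a root, that root is simple because the boxes are
    excluded, and [f'] has the same order as at the root. If [y] is small and [x] is far from all
    roots, [f(x)] has bounded order and dominates [y^m]. *)
Lemma nonsingular_bound (E : nat) : exists a : nat, forall z, O2 z ->
  (forall i, ideal 0 (gamma i) -> (2 <= nu i)%N -> ~ box (gamma i, 0) E E z) ->
  ~~ ideal a (superelliptic z) \/ ~~ ideal a (deriv_x z) \/ ~~ ideal a (deriv_y z).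
Proof.
have [E1 hE1] : exists E1, forall i, (absz (ord f^`().[gamma i]) < E1)%N.
  exists (\max_(i < k) absz (ord f^`().[gamma i])).+1 => i; rewrite ltnS.
  exact: (leq_bigmax (F := fun i => absz (ord f^`().[gamma i]))).
(* Within [M] of a simple root [f'] keeps its order; [a0] bounds the order of [f(x)] when no root is
   that close; [E2 > a0] makes [y^m] negligible against [f(x)]. Both [M] and [E2] are at least [E],
   so that close points fall into the excluded boxes. *)
pose M := maxn E E1.
pose a0 := (absz (ord gamma0) + \sum_(i < k) nu i * M)%N.
pose E2 := maxn E a0.+1.
exists (absz (ord (m%:R : K)) + m * E2 + E1 + a0).+1%N => z [z1 z2] hz.
have [y2|/idealNP[y0 oy]] := boolP (ideal E2 z.2); last first.
  have DE : deriv_y z = m%:R * z.2 ^+ m.-1 :> K.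
    by rewrite /deriv_y derivXn hornerMn hornerXn mulr_natl.
  have y1 : z.2 ^+ m.-1 != 0 by rewrite expf_neq0.
  right; right; rewrite DE /ideal mulf_eq0 (negPf m_neq0) (negPf y1) /=.
  rewrite ord_mul // ordX // -ltNge.
  have [b ob] := ord_nat y0 z2; rewrite ob in oy *.
  have : (m.-1 * b <= m * E2)%N by apply: leq_mul; lia.
  by ord_lia.
have [[i hi]|no] := pselect (exists i, ideal M (z.1 - gamma i)).
  have gi : ideal 0 (gamma i).
    by rewrite -(subKr z.1 (gamma i)); apply: idealB z1 _; apply: ideal_le hi; lia.
  right; left; case: (ltnP 1 (nu i)) => ni.
    case: (hz i gi ni); split=> /=; first by apply: ideal_le hi; lia.
    by rewrite subr0; apply: ideal_le y2; lia.
  have n1 : nu i = 1%N by have := nu_ge1 i; lia.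
  have d0 := deriv_simple_root n1.
  have lM := hE1 i.
  have oM : ord f^`().[gamma i] < M by move: lM; rewrite /M; ord_lia.
  have [|D0 oD] := @ord_dominant _ _ f^`().[z.1] M d0 oM.
    by apply: poly_lipschitz => //; exact: deriv_int.
  rewrite /deriv_x idealN /ideal (negPf D0) /= oD -ltNge.
  by move: lM; ord_lia.
left; have nz i : z.1 - gamma i != 0 /\ ord (z.1 - gamma i) < M.
  by apply: idealNP; apply/negP => h; apply: no; exists i.
have f0 : f.[z.1] != 0.
  rewrite horner_f mulf_neq0 //; apply/prodf_neq0 => i _.
  by rewrite expf_neq0 //; case: (nz i).
have of0 : ord f.[z.1] <= a0.
  rewrite horner_f ord_mul //; last first.
    by apply/prodf_neq0 => i _; rewrite expf_neq0 //; case: (nz i).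
  rewrite ord_prod; last by move=> i _; rewrite expf_neq0 //; case: (nz i).
  have : \sum_(i < k) ord ((z.1 - gamma i) ^+ nu i) <= ((\sum_(i < k) nu i * M)%N : int).
    rewrite (big_morph Posz PoszD (erefl (0%N : int))); apply: ler_sum => i _.
    have [zi0 zi] := nz i; rewrite ordX // PoszM; apply: ler_wpM2l => //.
    exact: ltW.
  move: (\sum_(i < k) ord _) => S hS; rewrite /a0 PoszD; apply: lerD => //.
  by ord_lia.
have mf0 : - f.[z.1] != 0 by rewrite oppr_eq0.
have mf1 : ord (- f.[z.1]) < E2 by rewrite ordN; move: of0; rewrite /E2; ord_lia.
have [|g0 og] := @ord_dominant _ _ (superelliptic z) E2 mf0 mf1.
  rewrite /superelliptic opprK subrK -(prednK (ltnW m_ge2)) exprS mulrC.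
  by apply: ideal_mulr => //; exact: idealX0.
rewrite /ideal (negPf g0) /= og ordN -ltNge.
by move: of0; ord_lia.
Qed.

End Superelliptic.

(** * Functional equations *)

Section FunctionalEquations.
Variables (K : localFieldType) (pi : K) (R : realType).
Variable mu : {measure set (borel2 K) -> \bar R}.
Hypothesis pi_unif : uniformizer pi.
Hypothesis mu_haar : normalized_haar mu.
Variable chi : K -> R[i].
Hypothesis chiP : mult_character chi.
Variables (c : nat) (r : seq K).
Hypothesis c_ge1 : (1 <= c)%N.
Hypothesis chi_cond : forall u, ideal c (u - 1) -> chi u = 1.
Hypothesis rP : is_reps c r.
Variable g : K * K -> K.
Hypothesis g_lip : integral_lipschitz g.
Implicit Types (A B S : set (borel2 K)) (z w : K * K).

Local Notation q := ((residue_card K)%:R : R).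
Local Notation O2 := (@integers2 K).
Local Notation vol := (vol mu).
Local Notation Z := (zeta pi mu chi g).
Local Notation t := (fun s : R[i] => cpow q (- s)).
Local Notation coefZ := (zeta_coef pi mu chi c r g).

(** [P] collects the initial terms outside the recurrence. Being chosen before [s], it lets the
    final numerator be one polynomial. *)
Lemma zeta_recurrence A B (EA EB l k0 : nat) (a : R[i]) :
  saturated EA (A : set (K * K)) -> A `<=` O2 ->
  saturated EB (B : set (K * K)) -> B `<=` O2 ->
  (forall k, (k0 <= k)%N -> coefZ B (k + l)%N = a * coefZ A k) ->
  exists P : {poly R[i]}, forall s, 0 < complex.Re s ->
    Z s B = a * t s ^+ l * Z s A + P.[t s].
Proof.
move=> satA sA satB sB rec.
exists (\poly_(k < k0 + l) coefZ B k - a *: ('X^l * \poly_(k < k0) coefZ A k)) => s s0.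
have pA := zeta_expansion pi_unif mu_haar chiP c_ge1 chi_cond rP g_lip s0 satA sA.
have pB := zeta_expansion pi_unif mu_haar chiP c_ge1 chi_cond rP g_lip s0 satB sB.
rewrite (power_sum_recurrence (cabs_t_lt1 K s0) rec pA pB); congr (_ + _).
rewrite hornerD hornerN hornerZ hornerM hornerXn !horner_poly.
by rewrite mulrA.
Qed.

Lemma zeta_smooth A (E N0 : nat) :
  saturated E (A : set (K * K)) -> A `<=` O2 ->
  (forall (N : nat) v, (N0 <= N)%N -> ideal N0 v ->
    vol (level g A v N) = q * vol (level g A v N.+1)) ->
  exists P : {poly R[i]}, forall s, 0 < complex.Re s ->
    (1 - (q^-1)%:C%C * t s) * Z s A = P.[t s].
Proof.
move=> satA sA hvol; have q1 := q_gt1 K R.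
have q0 : q != 0 by lra.
(* For [v] in [pi^N0 O] the levels of [v] and of 0 at precision [N0] coincide, so all later volumes
   depend on the precision only, and consecutive coefficients have ratio [1 / q]. *)
have volE (j : nat) v : ideal N0 v ->
    vol (level g A v (N0 + j)%N) = q ^- j * vol (level g A 0 N0).
  move=> hv; elim: j => [|j IH].
    rewrite addn0 expr0 invr1 mul1r; congr vol; apply/seteqP.
    split=> z [Az /= hz]; split=> //=; rewrite ?subr0 in hz *.
      by rewrite -(subrK v (g z)); exact: idealD.
    exact: idealB.
  have := hvol (N0 + j)%N v (leq_addr _ _) hv; rewrite IH addnS => E1.
  by apply: (mulfI q0); rewrite -E1 exprS invfM !mulrA mulfV // mul1r.
have [|P hP] := @zeta_recurrence A A E E 1 N0 (q^-1)%:C%C satA sA satA sA.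
  move=> k kN; rewrite /zeta_coef big_distrr; apply: eq_big_seq => u hu /=.
  have [_ _ u0 _] := unit_repsP c_ge1 rP hu.
  have hv (k' : nat) : (k <= k')%N -> ideal N0 (u * pi ^+ k').
    move=> kk; apply: ideal_mulr => //.
    by apply: ideal_le (ideal_piX pi_unif k'); lia.
  have E1 : vol (level g A (u * pi ^+ (k + 1)) (k + 1 + c)%N) =
      q ^- (k + 1 + c - N0) * vol (level g A 0 N0).
    rewrite -(volE _ _ (hv (k + 1)%N _)); last by lia.
    by congr (vol (level _ _ _ (Posz _))); lia.
  have E2 : vol (level g A (u * pi ^+ k) (k + c)%N) =
      q ^- (k + c - N0) * vol (level g A 0 N0).
    rewrite -(volE _ _ (hv k _)); last by lia.
    by congr (vol (level _ _ _ (Posz _))); lia.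
  rewrite E1 E2 (_ : (k + 1 + c - N0)%N = (k + c - N0).+1); last by lia.
  by rewrite exprS invfM -[_ * _ * vol _]mulrA [X in _ * X = _]rmorphM mulrCA.
exists P => s s0; have := hP s s0; rewrite expr1 => E1.
by rewrite mulrBl mul1r {1}E1 addrC addKr.
Qed.

End FunctionalEquations.

Lemma cabs_lt1_neq1 (R : realType) (x : R[i]) : cabs x < 1 -> 1 - x != 0.
Proof.
by move=> h; rewrite subr_eq0 eq_sym; apply/eqP => e; move: h; rewrite e cabs1 ltxx.
Qed.

(** * Rationality *)

Section Assembly.
Variables (R : realType) (K : localFieldType) (p : nat).
Hypothesis charK : p \in [pchar K].
Variable pi : K.
Hypothesis pi_unif : uniformizer pi.
Variable mu : {measure set (borel2 K) -> \bar R}.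
Hypothesis mu_haar : normalized_haar mu.
Variable m : nat.
Hypothesis m_ge2 : (2 <= m)%N.
Hypothesis p_ndvd_m : ~~ (p %| m)%N.
Variable f : {poly K}.
Hypothesis f_int : forall i, ideal 0 f`_i.
Variables (k : nat) (gamma0 : K) (gamma : 'I_k -> K) (nu : 'I_k -> nat).
Hypothesis gamma0_neq0 : gamma0 != 0.
Hypothesis gamma_inj : injective gamma.
Hypothesis nu_ge1 : forall i, (1 <= nu i)%N.
Hypothesis f_split : f = gamma0 *: \prod_(i < k) ('X - (gamma i)%:P) ^+ nu i.
Variable chi : K -> R[i].
Hypothesis chiP : mult_character chi.
Variables (c : nat) (r : seq K).
Hypothesis c_ge1 : (1 <= c)%N.
Hypothesis chi_cond : forall u, ideal c (u - 1) -> chi u = 1.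
Hypothesis rP : is_reps c r.
Variables (e e1 : nat).
Hypothesis e1P : forall i j, j != i -> ideal (- e1%:Z) (gamma i - gamma j)^-1.
Hypothesis eE : e = (e1 + c)%N.

Local Notation q := ((residue_card K)%:R : R).
Local Notation O2 := (@integers2 K).
Local Notation g := (superelliptic f m).
Local Notation Z := (zeta pi mu chi g).
Local Notation t := (fun s : R[i] => cpow q (- s)).
Local Notation dd := (fun i => gcdn (nu i) m).
Local Notation nt := (fun i => (nu i %/ dd i)%N).
Local Notation mt := (fun i => (m %/ dd i)%N).
Local Notation ll := (fun i => (nt i * mt i * dd i)%N).
Local Notation multiple := (fun i => (gamma i \in @integers K) && (2 <= nu i)%N).

Lemma m_natr_neq0 : m%:R != 0 :> K.
Proof. by rewrite -(dvdn_pcharf charK). Qed.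

Definition nbhd_root i : set (borel2 K) := box (gamma i, 0) e e.
Definition scaled_nbhd i : set (borel2 K) := box (gamma i, 0) (e + mt i)%N (e + nt i)%N.

Lemma nbhd_root_sub i : multiple i -> nbhd_root i `<=` O2.
Proof. by move=> /andP[gi _]; apply: box_sub_integers2; split=> //=; exact: ideal0. Qed.

Lemma scaled_sub i : scaled_nbhd i `<=` nbhd_root i.
Proof. by move=> z; apply: box_le; rewrite lez_nat leq_addr. Qed.

(** [ord (gamma i - gamma j) <= e1 < e], the last inequality being strict because [c >= 1]. *)
Lemma nbhd_root_disjoint i j z : i != j -> nbhd_root i z -> nbhd_root j z -> False.
Proof.
move=> ij [/= h1 _] [/= h2 _]; rewrite eq_sym in ij.
have d0 := gamma_sub_neq0 gamma_inj ij.
have : ideal e (gamma i - gamma j) by apply: ideal_trans h2; rewrite idealBC.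
have := e1P ij; rewrite /ideal invr_eq0 (negPf d0) /= ordV //.
by move: c_ge1; rewrite eE; ord_lia.
Qed.

Lemma smooth_away A (E : nat) : saturated E (A : set (K * K)) -> A `<=` O2 ->
  (forall z i, A z -> multiple i -> ~ scaled_nbhd i z) ->
  exists P : {poly R[i]}, forall s, 0 < complex.Re s ->
    (1 - (q^-1)%:C%C * t s) * Z s A = P.[t s].
Proof.
move=> satA sA away.
(* A box of radius [E'] around a singular point lies in its [scaled_nbhd], so avoiding the latter
   meets the requirement of [nonsingular_bound]. *)
pose E' := (e + \max_(i < k) (mt i + nt i))%N.
have E'P i : (e + mt i <= E')%N /\ (e + nt i <= E')%N.
  have := leq_bigmax (F := fun i => (mt i + nt i)%N) i; rewrite /E' /= !leq_add2l.
  by move=> h; split; apply: leq_trans h; rewrite ?leq_addl ?leq_addr.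
have [a ha] := nonsingular_bound f_int gamma0_neq0 gamma_inj nu_ge1 f_split m_ge2 m_natr_neq0 E'.
have lip := @superelliptic_lipschitz _ f m f_int.
pose D (b : bool) := if b then deriv_x f else deriv_y m : K * K -> K.
pose d (b : bool) : K * K := if b then (1, 0) else (0, 1).
have [] := @smooth_levels K pi R mu pi_unif mu_haar g A bool D d E a lip _ _ satA sA.
- case; [exact: deriv_x_derivative | exact: deriv_y_derivative].
- by case; split=> /=; rewrite ?ideal1 ?ideal0.
- move=> z Az; case: (ha z (sA _ Az)).
  + move=> i gi ni h; apply: (away z i Az); first by rewrite ni andbT.
    by apply: box_le h; rewrite lez_nat; case: (E'P i).
  + by left.
  + by case=> h; right; [exists true | exists false].
by move=> N0; exact: (zeta_smooth pi_unif mu_haar chiP c_ge1 chi_cond rP lip satA sA).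
Qed.

Lemma zeta_nbhd_root i : multiple i -> exists Q : {poly R[i]}, forall s, 0 < complex.Re s ->
  (1 - (q^-1)%:C%C * t s) *
  ((1 - (q ^- (mt i + nt i))%:C%C * t s ^+ ll i) * Z s (nbhd_root i)) = Q.[t s].
Proof.
move=> mi; have sN := nbhd_root_sub mi; have /andP[gi ni] := mi.
have lip := @superelliptic_lipschitz _ f m f_int.
have satN : saturated e (nbhd_root i : set (K * K)) by apply: saturated_box.
pose E := (e + mt i + nt i)%N.
have satS : saturated E (scaled_nbhd i : set (K * K)).
  by apply: saturated_box; rewrite lez_nat /E ?leq_addr // leq_add2r leq_addr.
have sS : scaled_nbhd i `<=` O2 by move=> z /scaled_sub /sN.
have satF : saturated E (nbhd_root i `\` scaled_nbhd i : set (K * K)).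
  by apply: saturatedD => //; apply: saturated_le satN; rewrite lez_nat /E -addnA leq_addr.
have [P hP] : exists P : {poly R[i]}, forall s, 0 < complex.Re s ->
    (1 - (q^-1)%:C%C * t s) * Z s (nbhd_root i `\` scaled_nbhd i) = P.[t s].
  apply: smooth_away satF _ _ => [z [/sN]//|z j [Nz Sz] mj Sj].
  have [ij|ij] := eqVneq j i; first by rewrite ij in Sj.
  by apply: (nbhd_root_disjoint ij _ Nz); exact: scaled_sub.
(* This is [H(pi^(m_i) x) / H(x)] in the factored form of [cofactor_at_scale]. *)
pose u x := \prod_(j < k | j != i)
  ((1 + x * (pi ^+ mt i * (gamma i - gamma j)^-1)) *
   (1 + x * (gamma i - gamma j)^-1)^-1) ^+ nu j.
have near j : j != i -> near_one e e1 c (fun x => 1 + x * (gamma i - gamma j)^-1).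
  by move=> ji; apply: near_one_affine => //; [rewrite eE | exact: e1P].
have u_near : near_one e e1 c u.
  apply: near_one_prod => // j ji; apply: near_oneX => //; apply: near_oneM => //.
    apply: near_one_affine => //; first by rewrite eE.
    by apply: ideal_mulr (e1P ji); apply: ideal_le (ideal_piX pi_unif (mt i)) => //.
  by apply: near_oneV => //; exact: near.
have dm : (mt i * dd i)%N = m by rewrite divnK // dvdn_gcdr.
have dn : (nt i * dd i)%N = nu i by rewrite divnK // dvdn_gcdl.
(* The threshold is 0, since the dilation relates the level sets for every [k]. The exponent [ll i]
   equals both [nu i * mt i] and [nt i * m], so [x^(n_i)] and [y^m] are scaled by the same power of
   [pi]. *)
have [|P2 hP2] := @zeta_recurrence K pi R mu pi_unif mu_haar chi chiP c r c_ge1 chi_cond rP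
    g lip (nbhd_root i) (scaled_nbhd i) e E (ll i) 0 (q ^- (mt i + nt i))%:C%C
    satN sN satS sS.
  move=> j _; rewrite /zeta_coef big_distrr; apply: eq_big_seq => v hv /=.
  have [_ _ v0 _] := unit_repsP c_ge1 rP hv.
  rewrite mulrCA -rmorphM /=; congr (_ * _%:C%C).
  apply: (vol_level_dilation pi_unif mu_haar charK (nu := nu i) (m := m)
     (H := cofactor_at gamma0 gamma nu i) c_ge1 _ _ p_ndvd_m _ u_near) => //.
  - by rewrite eE; lia.
  - by lia.
  - by move=> x; exact: horner_root.
  - move=> x ex; apply: cofactor_at_scale => // l li.
    by have [] := near_one_unit c_ge1 (near l li) ex.
  - by rewrite mulnAC dn.
  - by rewrite -mulnA dm.
exists (P + (1 - (q^-1)%:C%C *: 'X) * P2) => s s0.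
have mF : measurable (nbhd_root i `\` scaled_nbhd i) := saturated_measurable satF.
have mS : measurable (scaled_nbhd i) := saturated_measurable satS.
have E0 : Z s (nbhd_root i) = Z s (nbhd_root i `\` scaled_nbhd i) + Z s (scaled_nbhd i).
  rewrite -(zeta_additive pi_unif mu_haar chiP c_ge1 chi_cond rP lip s0 mF mS) //.
  - by rewrite setUC setDUK //; exact: scaled_sub.
  - by move=> z [/sN].
  - by apply/seteqP; split=> z // -[[]].
(* Inserting the recurrence for the smaller box and moving the multiple of [Z s (nbhd_root i)] to
   the left leaves the nonsingular complement and a polynomial. *)
have E2 : (1 - (q ^- (mt i + nt i))%:C%C * t s ^+ ll i) * Z s (nbhd_root i) =
    Z s (nbhd_root i `\` scaled_nbhd i) + P2.[t s].
  by rewrite mulrBl mul1r {1}E0 (hP2 s s0); ring.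
by rewrite E2 mulrDr hP // hornerD hornerM hornerD hornerN hornerZ hornerX hornerC.
Qed.

Definition zeta_denominator : {poly R[i]} := (1 - (q^-1)%:C%C *: 'X) *
  \prod_(i < k | multiple i) (1 - (q ^- (mt i + nt i))%:C%C *: 'X^(ll i)).

(** The disjoint neighbourhoods and their nonsingular complement partition [O2]. All pieces share
    the factor [1 - t / q], which therefore enters the common denominator only once. *)
Lemma zeta_rational : exists G : {poly R[i]}, forall s, 0 < complex.Re s ->
  zeta_denominator.[t s] * Z s O2 = G.[t s].
Proof.
have lip := @superelliptic_lipschitz _ f m f_int.
pose N i := nbhd_root i; pose B : set (borel2 K) := \bigcup_(i in [set i | multiple i]) N i.
have satN i : saturated e (N i : set (K * K)) by apply: saturated_box.
have satB : saturated e (B : set (K * K)).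
  by move=> z w [i mi Nz] zw; exists i => //; exact: satN Nz zw.
have satA : saturated e (O2 `\` B : set (K * K)).
  by apply: saturatedD => //; exact: integers2_saturated.
have sA : O2 `\` B `<=` O2 by move=> z [].
have sB : B `<=` O2 by move=> z [i mi Nz]; exact: nbhd_root_sub mi _ Nz.
have [P hP] : exists P : {poly R[i]}, forall s, 0 < complex.Re s ->
    (1 - (q^-1)%:C%C * t s) * Z s (O2 `\` B) = P.[t s].
  apply: smooth_away satA sA _ => z i [_ nB] mi Sz.
  by apply: nB; exists i => //; exact: scaled_sub.
have [i|Q hQ] := @choice _ _ (fun i Qi => multiple i -> forall s, 0 < complex.Re s ->
    (1 - (q^-1)%:C%C * t s) *
    ((1 - (q ^- (mt i + nt i))%:C%C * t s ^+ ll i) * Z s (N i)) = Qi.[t s]).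
  have [mi|nm] := pselect (multiple i); last by exists 0 => /nm.
  by have [Qi hQi] := zeta_nbhd_root mi; exists Qi.
pose F i : {poly R[i]} := 1 - (q ^- (mt i + nt i))%:C%C *: 'X^(ll i).
exists (P * \prod_(i < k | multiple i) F i +
  \sum_(i < k | multiple i) Q i * \prod_(j < k | multiple j && (j != i)) F j) => s s0.
have mA : measurable (O2 `\` B) := saturated_measurable satA.
have mB : measurable B := saturated_measurable satB.
have -> : Z s O2 = Z s (O2 `\` B) + \sum_(i < k | multiple i) Z s (N i).
  have zadd := zeta_additive pi_unif mu_haar chiP c_ge1 chi_cond rP lip s0.
  have <- : Z s B = \sum_(i < k | multiple i) Z s (N i).
    rewrite -big_filter; apply: (additive_partition zadd).
    - by apply: filter_uniq; exact: index_enum_uniq.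
    - by move=> i _; exact: saturated_measurable (satN i).
    - by move=> i; rewrite mem_filter => /andP[mi _]; exact: nbhd_root_sub.
    - move=> i j z _ _ Ni Nj; apply/eqP/negPn/negP => ij.
      exact: (nbhd_root_disjoint ij Ni Nj).
    - move=> z; split=> [[i mi Nz]|[i + Nz]]; last first.
        by rewrite mem_filter => /andP[mi _]; exists i.
      by exists i => //; rewrite mem_filter mem_index_enum andbT.
  rewrite -zadd //; first by rewrite setUC setDUK.
  by apply/seteqP; split=> z // -[[]].
have hF i : (F i).[t s] = 1 - (q ^- (mt i + nt i))%:C%C * t s ^+ ll i.
  by rewrite hornerD hornerN hornerZ hornerXn hornerC.
rewrite !hornerD !hornerM horner_sum hornerD hornerN hornerZ hornerX hornerC.
rewrite mulrDr; congr (_ + _); first by rewrite -hP // mulrAC.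
rewrite mulr_sumr; apply: eq_bigr => i mi.
rewrite hornerM -hQ // horner_prod (bigD1 i) //= hF horner_prod.
by ring.
Qed.

End Assembly.

Theorem theorem1p2 (R : realType) (K : localFieldType) (p : nat)
    (charK : p \in [pchar K])
    (pi : K) (pi_unif : uniformizer pi)
    (mu : {measure set (borel2 K) -> \bar R}) (mu_haar : normalized_haar mu)
    (m : nat) (m_ge2 : (2 <= m)%N) (p_ndvd_m : ~~ (p %| m)%N)
    (f : {poly K}) (f_int : f \is a polyOver (@integers K))
    (n : nat) (n_ge1 : (1 <= n)%N) (f_deg : size f = n.+1)
    (k : nat) (gamma0 : K) (gamma : 'I_k -> K) (nu : 'I_k -> nat)
    (gamma0_neq0 : gamma0 != 0) (gamma_inj : injective gamma)
    (nu_ge1 : forall i, (1 <= nu i)%N)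
    (nu_sum : (\sum_(i < k) nu i)%N = n)
    (f_split : f = gamma0 *: \prod_(i < k) ('X - (gamma i)%:P) ^+ nu i)
    (chi : K -> R[i]) (chi_char : mult_character chi) :
  let q : R := (residue_card K)%:R in
  let g := fun z : K * K => z.2 ^+ m - f.[z.1] in
  let d := fun i => gcdn (nu i) m in
  let nt := fun i => (nu i %/ d i)%N in
  let mt := fun i => (m %/ d i)%N in
  exists G : {poly R[i]}, forall s : R[i], 0 < complex.Re s ->
    local_zeta mu pi chi g s =
    G.[cpow q (- s)] /
    ((1 - cpow q (- 1 - s)) *
     \prod_(i < k | (gamma i \in @integers K) && (2 <= nu i)%N)
       (1 - cpow q (- (nt i)%:R - (mt i)%:R
                    - (nt i * mt i * d i)%:R * s))).
Proof.
move=> q g d nt mt.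
have [c c_ge1 chi_cond] := character_conductor chi_char.
have [r rP _] := reps_exist pi_unif c.
have f_coef i : ideal 0 f`_i.
  have [hi|hi] := ltnP i (size f); last by rewrite nth_default // ideal0.
  exact: (allP f_int) _ (mem_nth 0 hi).
(* Absolute values make the maximum a natural number; the pairs with [i = j] contribute the
   arbitrary value of [ord 0], which can only enlarge it. *)
have [e1 e1_max] : exists e1 : nat, forall i j, ord (gamma i - gamma j) <= e1.
  exists (\max_(ij : 'I_k * 'I_k) absz (ord (gamma ij.1 - gamma ij.2)%R))%N => i j.
  have := leq_bigmax (F := fun ij => absz (ord (gamma ij.1 - gamma ij.2)%R)) (i, j).
  rewrite /=; move: (\max_(_ : _) _)%N => M; ord_lia.
have e1P i j : j != i -> ideal (- e1%:Z) (gamma i - gamma j)^-1.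
  move=> ji; have d0 := gamma_sub_neq0 gamma_inj ji.
  by rewrite /ideal invr_eq0 (negPf d0) /= ordV // lerN2.
have [G hG] := zeta_rational charK pi_unif mu_haar m_ge2 p_ndvd_m f_coef gamma0_neq0
  gamma_inj nu_ge1 f_split chi_char c_ge1 chi_cond rP e1P (erefl (e1 + c)%N).
exists G => s s0; have q1 : 1 < q := q_gt1 K R; have q0 : 0 < q by lra.
have t1 := cabs_t_lt1 K s0; rewrite -/q in t1.
have qn (j : nat) : cpow q (- j%:R) = (q ^- j)%:C%C.
  by rewrite cpowN // -[j%:R]mulr1 cpowMn // cpow1r // -rmorphXn -fmorphV.
have E1 : cpow q (- 1 - s) = (q^-1)%:C%C * cpow q (- s).
  by rewrite cpowD // -(qn 1%N) ?expr1.
have E2 i : cpow q (- (nt i)%:R - (mt i)%:R - (nt i * mt i * d i)%:R * s) =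
    (q ^- (mt i + nt i))%:C%C * cpow q (- s) ^+ (nt i * mt i * d i).
  rewrite cpowD // -opprD -natrD qn -mulrN cpowMn //.
  by rewrite addnC.
have smallV (j : nat) : cabs (q ^- j)%:C%C <= 1.
  have qj : 1 <= q ^+ j by rewrite exprn_ege1 // ltW.
  by rewrite cabs_real ger0_norm ?invr_ge0 ?invf_le1 //; lra.
have -> : local_zeta mu pi chi g s = zeta pi mu chi (superelliptic f m) s (@integers2 K).
  by [].
have := hG s s0; rewrite /zeta_denominator hornerM horner_prod -/q.
rewrite hornerD hornerN hornerZ hornerX hornerC -E1.
under eq_bigr => i _ do rewrite hornerD hornerN hornerZ hornerXn hornerC -/(d i)
  -/(nt i) -/(mt i) -E2.
(* The denominator can be cancelled: for [Re s > 0] each term subtracted from 1 has modulus less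
   than 1. *)
move=> <-; rewrite mulrC mulKf // mulf_neq0 //.
  apply: cabs_lt1_neq1; rewrite E1 cabsM; have := smallV 1%N; rewrite expr1.
  have := cabs_ge0 (cpow q (- s)); have := cabs_ge0 (q^-1)%:C%C; nra.
apply/prodf_neq0 => i mi; apply: cabs_lt1_neq1; rewrite E2 cabsM cabsX.
have d0 : (0 < d i)%N by rewrite gcdn_gt0 nu_ge1.
have nt0 : (0 < nt i)%N.
  by rewrite /nt divn_gt0 //; apply: dvdn_leq; [exact: nu_ge1 | exact: dvdn_gcdl].
have mt0 : (0 < mt i)%N.
  by rewrite /mt divn_gt0 //; apply: dvdn_leq; [exact: ltnW | exact: dvdn_gcdr].
(* From [|t| < 1] the strict bound [|t|^l < 1] follows only for a positive exponent. *)
have l0 : (0 < nt i * mt i * d i)%N by rewrite 2!muln_gt0 nt0 mt0 d0.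
move: (nt i * mt i * d i)%N l0 => l l0.
apply: (@le_lt_trans _ _ (cabs (cpow q (- s)) ^+ l)).
  by rewrite ler_piMl // exprn_ge0 // cabs_ge0.
by rewrite exprn_ilt1 ?cabs_ge0 // -lt0n.
Qed.
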